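(* Let $T>0$, $d\ge1$, and fix $A,B,C\in L^\infty(0,T;\mathbb{R}^{d\times d})$ and $D\in C([0,T];\mathbb{R}^{d\times d})$. Let $\mathfrak{S}\subset C([0,T];\mathcal{S}^d)\times L^\infty(0,T;\mathcal{S}^d)\times\mathcal{S}^d$ be the solvable set associated with $(A,B,C,D)$, i.e. the set of all triples $(R,Q,G)$ for which the Riccati problem $$\dot P+A^\top P+PA+C^\top PC+Q=(PB+C^\top PD)(R+D^\top PD)^{-1}(PB+C^\top PD)^\top,\qquad P(T)=G,$$ $$R+D^\top PD>0\quad\text{over }[0,T],$$ admits a solution $P$ over $[0,T]$. Then $\mathfrak{S}$ is a nonempty convex cone excluding the origin $(0,0,0)$. More specifically, denoting by $P(R,Q,G)$ the solution associated with $(R,Q,G)\in\mathfrak{S}$, the following hold: (a) Positive homogeneity: if $(R,Q,G)\in\mathfrak{S}$ and $\lambda>0$, then $(\lambda R,\lambda Q,\lambda G)\in\mathfrak{S}$ and $P(\lambda R,\lambda Q,\lambda G)=\lambda P(R,Q,G)$. (b) Super-additivity: if $(R,Q,G)\in\mathfrak{S}$ and $(\bar R,\bar Q,\bar G)\in\mathfrak{S}$, then $(R+\bar R,Q+\bar Q,G+\bar G)\in\mathfrak{S}$ and $$P(R+\bar R,Q+\bar Q,G+\bar G)\ge P(R,Q,G)+P(\bar R,\bar Q,\bar G).$$ (c) Monotonicity: if $(R,Q,G)\in\mathfrak{S}$ and $(\bar R,\bar Q,\bar G)\in C([0,T];\mathcal{S}^d)\times L^\infty(0,T;\mathcal{S}^d)\times\mathcal{S}^d$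 satisfies $R\le\bar R$, $Q\le\bar Q$, $G\le\bar G$, then $(\bar R,\bar Q,\bar G)\in\mathfrak{S}$ and $P(R,Q,G)\le P(\bar R,\bar Q,\bar G)$.
   Context: $\mathcal{S}^d$ is the set of real symmetric $d\times d$ matrices with the usual semi-order: $M\ge N$ (resp. $M>N$) means that $M-N$ is positive semidefinite (resp. positive definite). Inequalities between matrix functions are pointwise in time on $[0,T]$ (almost everywhere for $L^\infty$ functions). A solution $P$ of the Riccati problem is an absolutely continuous function $P:[0,T]\to\mathcal{S}^d$ satisfying the differential equation for almost every $t$, the terminal condition $P(T)=G$, and $R(t)+D(t)^\top P(t)D(t)>0$ for every $t\in[0,T]$. It is a known fact that such a solution is unique when it exists, so that $P(R,Q,G)$ is well defined. A convex cone here is a convex set closed under multiplication by positive scalars $\lambda>0$. *)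

(* Defs.v *)
From HB Require Import structures.
From mathcomp Require Import all_boot all_order all_algebra.
From mathcomp Require Import all_classical all_reals all_analysis.

Set Implicit Arguments.
Unset Strict Implicit.
Unset Printing Implicit Defensive.

Import Order.TTheory GRing.Theory Num.Theory.
Import numFieldNormedType.Exports.

Local Open Scope classical_set_scope.
Local Open Scope ring_scope.

Definition psdmx (R : realType) (d : nat) (M : 'M[R]_d) : Prop :=
  M \is symmetricmx /\ forall x : 'cV[R]_d, 0 <= (x^T *m M *m x) 0 0.

Definition pdmx (R : realType) (d : nat) (M : 'M[R]_d) : Prop :=
  M \is symmetricmx /\
  forall x : 'cV[R]_d, x != 0 -> 0 < (x^T *m M *m x) 0 0.

Definition loewner_le (R : realType) (d : nat) (M N : 'M[R]_d) : Prop :=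
  psdmx (N - M).

(* Cones need only be closed under strictly positive scalars, so they need not
   contain the origin. *)
Definition convex_cone (R : realType) (V : lmodType R) (S : set V) : Prop :=
  convex_set S /\ forall (l : R) (v : V), 0 < l -> S v -> S (l *: v).

(* Functions on [0, T] are represented by total functions on R whose values
   outside [0, T] are irrelevant: the two-sided derivative in the Riccati equation
   is required only almost everywhere, so the endpoints do not matter.  Elements
   of L^oo are represented by Borel functions. *)
Definition Linfty (R : realType) (d : nat) (T : R) (f : R -> 'M[R]_d) : Prop :=
  (forall i j, measurable_fun `[0, T]%classic (fun t : R => f t i j)) /\
  exists c : R,
    \forall t \ae (@lebesgue_measure R), t \in `[0, T] -> `|f t| <= c.

Definition abs_continuous (R : realType) (V : normedModType R) (a b : R)
    (f : R -> V) : Prop :=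
  forall e : R, 0 < e -> exists2 delta : R, 0 < delta &
    forall (n : nat) (u v : 'I_n -> R),
      (forall i, a <= u i /\ u i <= v i /\ v i <= b) ->
      (forall i j, i != j -> v i <= u j \/ v j <= u i) ->
      \sum_i (v i - u i) < delta ->
      \sum_i `|f (v i) - f (u i)| < e.

Notation riccati_data R d :=
  ((R -> 'M[R]_d) * (R -> 'M[R]_d) * 'M[R]_d)%type.

(* C([0,T]; S^d) x L^oo(0,T; S^d) x S^d *)
Definition data_space (R : realType) (d : nat) (T : R) :
    set (riccati_data R d) :=
  [set p : riccati_data R d | let: (Rc, Q, G) := p in
    [/\ {within `[0, T], continuous Rc},
        forall t : R, t \in `[0, T] -> Rc t \is symmetricmx,
        Linfty T Q,
        \forall t \ae (@lebesgue_measure R), t \in `[0, T] -> Q t \is symmetricmx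
      & G \is symmetricmx]].

(* Equality of the elements of C([0,T]; S^d) x L^oo(0,T; S^d) x S^d that two
   triples of functions represent. *)
Definition data_eq (R : realType) (d : nat) (T : R)
    (p q : riccati_data R d) : Prop :=
  [/\ forall t : R, t \in `[0, T] -> p.1.1 t = q.1.1 t,
      \forall t \ae (@lebesgue_measure R), t \in `[0, T] -> p.1.2 t = q.1.2 t
    & p.2 = q.2].

Definition riccati_solution (R : realType) (d : nat) (T : R)
    (A B C D : R -> 'M[R]_d) (p : riccati_data R d)
    (P : R -> 'M[R]_d) : Prop :=
  let: (Rc, Q, G) := p in
  [/\ forall t : R, t \in `[0, T] -> P t \is symmetricmx,
      abs_continuous 0 T P,
      \forall t \ae (@lebesgue_measure R), t \in `[0, T] ->
        derivable P t 1 /\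
        let K := P t *m B t + (C t)^T *m P t *m D t in
        derive1 P t + (A t)^T *m P t + P t *m A t + (C t)^T *m P t *m C t + Q t
          = K *m invmx (Rc t + (D t)^T *m P t *m D t) *m K^T,
      P T = G
    & forall t : R, t \in `[0, T] -> pdmx (Rc t + (D t)^T *m P t *m D t)].

Definition solvable_set (R : realType) (d : nat) (T : R)
    (A B C D : R -> 'M[R]_d) : set (riccati_data R d) :=
  [set p | data_space T p /\ exists P, riccati_solution T A B C D p P].

(* Main.v *)
(* For symmetric [X] with [S = R + D^T X D > 0], completing the square shows that

     A^T X + X A + C^T X C + Q - (X B + C^T X D) S^-1 (X B + C^T X D)^T

   is the minimum over the matrices [Th], in the Loewner order, of

     J(Th, X) = (A - B Th)^T X + X (A - B Th) + (C - D Th)^T X (C - D Th)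
                + Q + Th^T R Th,

   attained at the feedback [Th = S^-1 (X B + C^T X D)^T].  Call [W] a subsolution
   if [R + D^T W D > 0] and [- W' <= J(Th, W)] almost everywhere for every [Th].
   Solutions are subsolutions of their own data, and subsolutions are preserved by
   sums, by positive scalings and by increasing the data, so all the claims follow
   from one fact: if [W] is a subsolution with [W(T) <= G], then the Riccati problem
   has a solution, and every solution dominates [W].

   A solution solves the linear equation [- P' = J(Th, P)] for its own feedback
   [Th], while [- W' <= J(Th, W)]; the comparison thus reduces to the positivity of
   solutions of linear Lyapunov inequalities.  Existence is policy iteration:
   [P_(k+1)] solves the linear equation whose [Th] is the feedback of [P_k].  Then
   [W <= P_(k+1) <= P_k], which bounds the iterates and keeps [R + D^T P_k D]
   uniformly positive; the feedback is therefore Lipschitz along the iteration,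
   which converges geometrically in a norm weighted by an exponential. *)
Require Import Defs.
From HB Require Import structures.
From mathcomp Require Import all_boot all_order all_algebra.
From mathcomp Require Import all_classical all_reals all_analysis.
From mathcomp Require Import measurable_realfun ring lra.

Set Implicit Arguments.
Unset Strict Implicit.
Unset Printing Implicit Defensive.

Import Order.TTheory GRing.Theory Num.Theory.
Import numFieldNormedType.Exports.

Local Open Scope classical_set_scope.
Local Open Scope ring_scope.

#[local] Instance lebesgue_ae_filter (R : realType) :
  Filter (nbhs (almost_everywhere (@lebesgue_measure R))) :=
  ae_filter_ringOfSetsType (@lebesgue_measure R).

(** * Quadratic forms and the Loewner order *)

Section QuadraticForms.
Context {R : realType} {d : nat}.
Implicit Types (M N : 'M[R]_d) (x y : 'cV[R]_d).

Definition bform M x y : R := (x^T *m M *m y) 0 0.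
Definition qform M x : R := bform M x x.
Definition sqnorm x : R := (x^T *m x) 0 0.

(** [symmetricmx] is the hermitian predicate with sign [1] and trivial conjugation; the proof strips
    both. *)
Lemma symmetricmxP M : M \is symmetricmx <-> M^T = M.
Proof.
rewrite qualifE expr0 scale1r (_ : map_mx _ _ = M^T).
  by split=> [/eqP <-|->].
by apply/matrixP => i j; rewrite !mxE.
Qed.

Lemma bformC M x y : M^T = M -> bform M x y = bform M y x.
Proof.
move=> MT; rewrite /bform -[LHS](mxE trmx_key (fun i j => (x^T *m M *m y) j i)).
by rewrite -/(trmx _) !trmx_mul trmxK MT mulmxA.
Qed.

Lemma bformDl M x y z : bform M (x + y) z = bform M x z + bform M y z.
Proof. by rewrite /bform linearD /= !mulmxDl mxE. Qed.

Lemma bformDr M x y z : bform M x (y + z) = bform M x y + bform M x z.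
Proof. by rewrite /bform mulmxDr mxE. Qed.

Lemma bformZl M k x y : bform M (k *: x) y = k * bform M x y.
Proof. by rewrite /bform linearZ /= -!scalemxAl mxE. Qed.

Lemma bformZr M k x y : bform M x (k *: y) = k * bform M x y.
Proof. by rewrite /bform -!scalemxAr mxE. Qed.

Lemma bform_sum M x y : bform M x y = \sum_i \sum_j x i 0 * M i j * y j 0.
Proof.
rewrite /bform mxE exchange_big /=; apply: eq_bigr => j _; rewrite mxE mulr_suml.
by apply: eq_bigr => i _; rewrite mxE.
Qed.

Lemma qformD M N x : qform (M + N) x = qform M x + qform N x.
Proof. by rewrite /qform /bform mulmxDr mulmxDl mxE. Qed.

Lemma qformN M x : qform (- M) x = - qform M x.
Proof. by rewrite /qform /bform mulmxN mulNmx mxE. Qed.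

Lemma qformB M N x : qform (M - N) x = qform M x - qform N x.
Proof. by rewrite qformD qformN. Qed.

Lemma qformZ k M x : qform (k *: M) x = k * qform M x.
Proof. by rewrite /qform /bform -scalemxAr -scalemxAl mxE. Qed.

Lemma qform1 x : qform 1%:M x = sqnorm x.
Proof. by rewrite /qform /bform mulmx1. Qed.

Lemma qform_conj M (H : 'M[R]_d) x : qform (H^T *m M *m H) x = qform M (H *m x).
Proof. by rewrite /qform /bform trmx_mul !mulmxA. Qed.

Lemma bform_delta M i j : bform M (delta_mx i 0) (delta_mx j 0) = M i j.
Proof. by rewrite /bform trmx_delta -rowE -colE !mxE. Qed.

Lemma sqnormE x : sqnorm x = \sum_i x i 0 ^+ 2.
Proof. by rewrite /sqnorm mxE; apply: eq_bigr => i _; rewrite mxE expr2. Qed.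

Lemma sqnorm_ge0 x : 0 <= sqnorm x.
Proof. by rewrite sqnormE sumr_ge0 // => i _; rewrite sqr_ge0. Qed.

Lemma sqnorm_eq0 x : (sqnorm x == 0) = (x == 0).
Proof.
apply/idP/eqP => [|->]; last first.
  by rewrite sqnormE big1 // => i _; rewrite mxE expr0n.
rewrite sqnormE psumr_eq0 => [/allP h|i _]; last exact: sqr_ge0.
apply/matrixP => i j; rewrite ord1 mxE; apply/eqP; rewrite -sqrf_eq0.
by apply: h; rewrite mem_index_enum.
Qed.

Lemma sqnorm_gt0 x : (0 < sqnorm x) = (x != 0).
Proof. by rewrite lt_def sqnorm_ge0 andbT sqnorm_eq0. Qed.

Lemma qform_psd_ge0 M x : psdmx M -> 0 <= qform M x.
Proof. by case=> _ /(_ x). Qed.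

Lemma psd_sym M : psdmx M -> M^T = M.
Proof. by case=> /symmetricmxP. Qed.

Lemma pd_psd M : pdmx M -> psdmx M.
Proof.
move=> [sM pM]; split=> // x; have [->|x0] := eqVneq x 0; last exact/ltW/pM.
by rewrite mulmx0 mxE.
Qed.

(** With [a], [b], [c] the values of the form at [(x, x)], [(x, y)], [(y, y)], evaluating it at
    [c x - b y] gives [c (a c - b^2)], which settles the case [c > 0]. *)
Lemma psd_cauchy_schwarz M x y : psdmx M ->
  bform M x y ^+ 2 <= qform M x * qform M y.
Proof.
move=> pM; have sM := psd_sym pM.
have E u v : qform M (u *: x + v *: y) =
   u ^+ 2 * qform M x + 2 * u * v * bform M x y + v ^+ 2 * qform M y.
  rewrite /qform bformDl !bformDr !bformZl !bformZr (bformC y x sM); ring.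
have h u v : 0 <= qform M (u *: x + v *: y) by apply: qform_psd_ge0.
have {h} h u v := (eq_ind _ (fun z => 0 <= z) (h u v) _ (E u v)).
have := qform_psd_ge0 x pM; have := qform_psd_ge0 y pM.
set a := qform M x in h *; set c := qform M y in h *; set b := bform M x y in h *.
rewrite le_eqVlt => /predU1P[c0|c_gt0] a_ge0.
  (* When [c = 0], these coefficients give the value [- b ^+ 2]. *)
  move: (h (b) (- (a + 1) / 2)); rewrite -c0 => hb.
  nra.
move: (h c (- b)) => hb.
have {}hb : 0 <= c * (a * c - b ^+ 2).
  by apply: le_trans hb _; rewrite le_eqVlt; apply/orP; left; apply/eqP; ring.
by rewrite -subr_ge0 -(pmulr_rge0 _ c_gt0).
Qed.

(** Cauchy-Schwarz for the pair [M x], [x] bounds the square of [sqnorm (M x)] by zero. *)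
Lemma psd_qform0 M x : psdmx M -> qform M x = 0 -> M *m x = 0.
Proof.
move=> pM q0; apply/eqP; rewrite -sqnorm_eq0 -sqrf_eq0.
have := psd_cauchy_schwarz (M *m x) x pM; rewrite q0 mulr0.
have -> : bform M (M *m x) x = sqnorm (M *m x) by rewrite /bform /sqnorm mulmxA.
by move=> h; rewrite eq_le h sqr_ge0.
Qed.

Lemma le_mxnorm m n (A : 'M[R]_(m, n)) i j : `|A i j| <= `|A|.
Proof. by rewrite [leRHS]mx_normrE; exact: (le_bigmax _ _ (i, j)). Qed.

Lemma mxnorm_le m n (A : 'M[R]_(m, n)) c : 0 <= c ->
  (forall i j, `|A i j| <= c) -> `|A| <= c.
Proof. by move=> c0 h; rewrite [leLHS]mx_normrE; apply: bigmax_le => // -[i j]. Qed.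

(** The norm is the largest absolute value of an entry, which is not submultiplicative; hence the
    factor [n]. *)
Lemma mxnorm_mul m n p (A : 'M[R]_(m, n)) (B : 'M[R]_(n, p)) :
  `|A *m B| <= n%:R * (`|A| * `|B|).
Proof.
apply: mxnorm_le => [|i j]; first by rewrite !mulr_ge0.
rewrite mxE (le_trans (ler_norm_sum _ _ _)) //.
set c := _ * `|B|; rewrite mulr_natl -[n in leRHS]card_ord -sumr_const.
apply: ler_sum => k _; rewrite {}/c.
by rewrite normrM ler_pM // le_mxnorm.
Qed.

Lemma mxnorm_tr m n (A : 'M[R]_(m, n)) : `|A^T| = `|A|.
Proof.
apply/eqP; rewrite eq_le; apply/andP; split; apply: mxnorm_le => // i j.
  by rewrite mxE le_mxnorm.
by have := le_mxnorm A^T j i; rewrite mxE.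
Qed.

(** Bounding [|x_i y_j|] by [x_i^2 + y_j^2] keeps every estimate in terms of [sqnorm], without
    square roots. *)
Lemma bform_le M x y : `|bform M x y| <= d%:R * `|M| * (sqnorm x + sqnorm y).
Proof.
rewrite bform_sum (le_trans (ler_norm_sum _ _ _)) //.
apply: (@le_trans _ _ (\sum_(i < d) \sum_(j < d) `|M| * (x i 0 ^+ 2 + y j 0 ^+ 2))).
  apply: ler_sum => i _; rewrite (le_trans (ler_norm_sum _ _ _)) //.
  apply: ler_sum => j _; rewrite !normrM mulrAC [leRHS]mulrC ler_pM ?mulr_ge0 //.
    have := sqr_ge0 (`|x i 0| - `|y j 0|).
    rewrite -(real_normK (num_real (x i 0))) -(real_normK (num_real (y j 0))).
    move: (normr_ge0 (x i 0)) (normr_ge0 (y j 0)) => *; nra.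
  exact: le_mxnorm.
under eq_bigr do rewrite -mulr_sumr big_split /= sumr_const card_ord -sqnormE.
rewrite -mulr_sumr big_split /= sumr_const card_ord sumrMnl -sqnormE.
by rewrite -mulrnDl -[_ *+ d]mulr_natl mulrCA mulrA.
Qed.

Lemma qform_le M x : `|qform M x| <= 2 * d%:R * `|M| * sqnorm x.
Proof. by apply: le_trans (bform_le _ _ _) _; lra. Qed.

Definition coercive (a : R) M := forall x, a * sqnorm x <= qform M x.

Lemma coercive_unit a M : 0 < a -> M^T = M -> coercive a M -> M \in unitmx.
Proof.
move=> a0 sM cM; rewrite -row_free_unit; apply: inj_row_free => v vM.
have : qform M v^T = 0 by rewrite /qform /bform trmxK vM mul0mx mxE.
move=> q0; have := cM v^T; rewrite q0 pmulr_rle0 // => h.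
have : sqnorm v^T == 0 by rewrite eq_le h sqnorm_ge0.
by rewrite sqnorm_eq0 => /eqP vT0; rewrite -[v]trmxK vT0 trmx0.
Qed.

Lemma coercive_pd a M : 0 < a -> M^T = M -> coercive a M -> pdmx M.
Proof.
move=> a0 sM cM; split; first exact/symmetricmxP.
move=> x x0; apply: lt_le_trans (cM x).
by rewrite mulr_gt0 // sqnorm_gt0.
Qed.

(** For a column [y = M^-1 e] of the inverse, [a |y|^2 <= y^T M y = <y, e>], and Cauchy-Schwarz
    gives [|y| <= 1 / a]. *)
Lemma coercive_inv_le a M : 0 < a -> M^T = M -> coercive a M -> `|invmx M| <= a^-1.
Proof.
move=> a0 sM cM; have uM := coercive_unit a0 sM cM.
apply: mxnorm_le => [|i j]; first by rewrite invr_ge0 ltW.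
pose e : 'cV[R]_d := delta_mx j 0; pose y := invmx M *m e.
have -> : invmx M i j = y i 0 by rewrite /y /e -colE mxE.
have qy : qform M y = bform 1%:M y e.
  by rewrite /qform /bform -mulmxA mulmxA mulmx1 -[_ *m M *m y]mulmxA mulKVmx.
have sq_e : sqnorm e = 1.
  rewrite -qform1 /qform bform_delta mxE eqxx //.
have : qform M y ^+ 2 <= sqnorm y * sqnorm e.
  rewrite qy -!qform1; apply: psd_cauchy_schwarz; split.
    by apply/symmetricmxP; rewrite trmx1.
  by move=> x; rewrite -/(bform _ _ _) -/(qform _ _) qform1 sqnorm_ge0.
rewrite sq_e mulr1 => h; have := cM y => h2.
have y0 := sqnorm_ge0 y.
have yi : y i 0 ^+ 2 <= sqnorm y.
  by rewrite sqnormE (bigD1 i) //= lerDl sumr_ge0 // => *; exact: sqr_ge0.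
have {}h2 : (a * sqnorm y) ^+ 2 <= sqnorm y.
  by apply: le_trans h; rewrite ler_sqr ?nnegrE ?mulr_ge0 // ?(ltW a0) //;
     apply: le_trans h2; rewrite mulr_ge0 // ltW.
have {h2} h3 : sqnorm y <= a^-1 ^+ 2.
  have [->|yn0] := eqVneq (sqnorm y) 0; first by rewrite sqr_ge0.
  have ygt : 0 < sqnorm y by rewrite lt_def yn0.
  rewrite exprVn -[leRHS]mul1r ler_pdivlMr ?exprn_gt0 //.
  by rewrite -(ler_pM2l ygt) mulr1; move: h2; rewrite exprMn; lra.
rewrite -ler_sqr ?nnegrE // ?invr_ge0 ?(ltW a0) // real_normK ?num_real //.
exact: le_trans h3.
Qed.

(** No compactness of the sphere is invoked: Cauchy-Schwarz for [M] between [x] and [M^-1 x] reads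
    [|x|^4 <= (x^T M x) (x^T M^-1 x)], and a bound on the form of [M^-1] yields the constant. *)
Lemma pd_coercive M : pdmx M -> exists2 a, 0 < a & coercive a M.
Proof.
move=> pM; have sM : M^T = M by apply/psd_sym/pd_psd.
have uM : M \in unitmx.
  rewrite -row_free_unit; apply: inj_row_free => v vM.
  apply/eqP; rewrite -trmx_eq0; apply/negPn/negP => /(proj2 pM).
  by rewrite trmxK vM mul0mx mxE ltxx.
pose c := 2 * d%:R * `|invmx M| + 1.
have c0 : 0 < c by rewrite ltr_wpDl // !mulr_ge0.
exists c^-1; first by rewrite invr_gt0.
move=> x; rewrite mulrC ler_pdivrMr //.
have [->|x0] := eqVneq x 0.
  by rewrite /qform /bform /sqnorm !mulmx0 mxE mul0r.
have s0 : 0 < sqnorm x by rewrite sqnorm_gt0.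
have qM : 0 <= qform M x by apply/qform_psd_ge0/pd_psd.
have := psd_cauchy_schwarz x (invmx M *m x) (pd_psd pM).
have -> : bform M x (invmx M *m x) = sqnorm x.
  by rewrite /bform -mulmxA mulKVmx.
have -> : qform M (invmx M *m x) = qform (invmx M) x.
  by rewrite /qform /bform -!mulmxA mulKVmx // trmx_mul trmx_inv sM -mulmxA.
have := qform_le (invmx M) x; rewrite ler_norml => /andP[_ h1] h2.
have h3 : qform (invmx M) x <= c * sqnorm x by apply: le_trans h1 _; rewrite /c; nra.
have : sqnorm x ^+ 2 <= qform M x * (c * sqnorm x).
  by apply: le_trans h2 _; rewrite ler_wpM2l.
by rewrite expr2 mulrA ler_pM2r.
Qed.

Lemma coercive_perturb a M N : coercive a M ->
  coercive (a - 2 * d%:R * `|N - M|) N.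
Proof.
move=> cM x; have := cM x; have := qform_le (N - M) x.
rewrite qformB ler_norml => /andP[h _]; lra.
Qed.

Lemma loewner_qform M N : loewner_le M N -> forall x, qform M x <= qform N x.
Proof. by move=> h x; have := qform_psd_ge0 x h; rewrite qformB subr_ge0. Qed.

Lemma qform_loewner M N : M^T = M -> N^T = N ->
  (forall x, qform M x <= qform N x) -> loewner_le M N.
Proof.
move=> sM sN h; split; first by apply/symmetricmxP; rewrite linearB /= sM sN.
by move=> x; have := h x; rewrite -subr_ge0 -qformB.
Qed.

(** By Cauchy-Schwarz the entries of a positive semidefinite matrix are controlled by its diagonal,
    and diagonal entries are monotone in the Loewner order. *)
Lemma psd_norm_le M N : psdmx M -> loewner_le M N -> `|M| <= `|N|.
Proof.
move=> pM MN; apply: mxnorm_le => // i j.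
have /= := psd_cauchy_schwarz (delta_mx i 0) (delta_mx j 0) pM.
rewrite bform_delta => h.
have hd k : 0 <= qform M (delta_mx k 0) <= `|N|.
  rewrite qform_psd_ge0 //= (le_trans (loewner_qform MN _)) //.
  by rewrite /qform bform_delta (le_trans (ler_norm _)) // le_mxnorm.
have /andP[i0 iN] := hd i; have /andP[j0 jN] := hd j.
rewrite -ler_sqr ?nnegrE // real_normK ?num_real // (le_trans h) // expr2.
exact: ler_pM.
Qed.

End QuadraticForms.

(** * Absolutely continuous functions *)

Section AbsolutelyContinuous.
Context {R : realType}.
Notation mu := (@lebesgue_measure R).

(** A compactness principle in the style of Cousin: an additive property of intervals that holds on
    small intervals around each point holds globally. It serves for finite subdivisions, boundedness
    and uniform coercivity. *)
Lemma interval_additive (a b : R) (S : R -> R -> Prop) : a <= b ->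
  (forall x y z, a <= x -> x <= y -> y <= z -> z <= b ->
    S x y -> S y z -> S x z) ->
  (forall t, a <= t -> t <= b -> exists2 e : R, 0 < e &
    forall u v, a <= u -> u <= t -> t <= v -> v <= b -> v - u < e -> S u v) ->
  S a b.
Proof.
move=> ab addS locS; pose E := [set x | [/\ a <= x, x <= b & S a x]].
have Ea : E a.
  by split=> //; have [e e0 h] := locS a (lexx a) ab; apply: h => //; rewrite subrr.
have supE : has_sup E by split; [exists a | exists b => x []].
have as_ : a <= sup E by apply: sup_upper_bound.
have sb : sup E <= b by apply: ge_sup => [|x []]; first by exists a.
have [e e0 h] := locS _ as_ sb.
have [x [ax xb Sx] sx] := sup_adherent (divr_gt0 e0 (ltr0Sn R 1)) supE.
have xs : x <= sup E by apply: sup_upper_bound.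
(* As [x > sup E - e / 2], the interval from [x] to [v] is shorter than [e] and contains [sup E]; so
   [v] is in [E], which forces [v = b]. *)
pose v := Num.min b (sup E + e / 4).
have sv : sup E <= v by rewrite /v le_min sb /= lerDl divr_ge0 // ltW.
have vb : v <= b by rewrite /v ge_min lexx.
have ve : v <= sup E + e / 4 by rewrite /v ge_min lexx orbT.
have Sv : S a v.
  apply: (addS a x v) => //; first exact: le_trans sv.
  by apply: h => //; move: sx ve; lra.
have {}Ev : E v by split=> //; exact: le_trans sv.
have vs : v <= sup E by apply: sup_upper_bound.
suff <- : v = b by [].
by move: vs; rewrite /v; case: (leP b (sup E + e / 4)) => // _; move: e0; lra.
Qed.

(** The half-open intervals are pairwise disjoint, so additivity turns the sum of their lengths into
    the measure of a subset of [U]. *)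
Lemma total_length_lt (U : set R) n (p q : 'I_n -> R) (e : R) :
  measurable U -> (mu U < e%:E)%E ->
  (forall i, p i <= q i /\ `[p i, q i[ `<=` U) ->
  (forall i j, i != j -> q i <= p j \/ q j <= p i) ->
  \sum_i (q i - p i) < e.
Proof.
move=> mU Ue pqU dpq; rewrite -lte_fin; apply: le_lt_trans Ue.
have mI : measurable (\big[setU/set0]_(i < n) [set` `[p i, q i[]).
  by apply: bigsetU_measurable => i _; exact: measurable_itv.
rewrite -sumEFin (eq_bigr (fun i => mu `[p i, q i[)) => [|i _]; last first.
  rewrite lebesgue_measure_itv /= lte_fin; case: ltP => // qp.
  by rewrite (le_anti (introT andP (conj qp (proj1 (pqU i))))) subrr.
rewrite -measure_semi_additive_ord //; last first.
  apply/trivIsetP => i j _ _ ij; rewrite -subset0 => x [/=].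
  rewrite !in_itv /= => /andP[x1 x2] /andP[x3 x4].
  by case: (dpq i j ij) => [/(lt_le_trans x2)|/(lt_le_trans x4)] /lt_geF;
     rewrite ?x3 ?x1.
apply: le_measure; rewrite ?inE //.
by elim/big_ind: _ => // [A B AU BU|i _]; [rewrite subUset | exact: (proj2 (pqU i))].
Qed.

(* [a, b] is cut into small intervals: those around a point of the exceptional
   null set lie in an open set of small measure, so absolute continuity bounds
   their total contribution; on the others [F] decreases by at most [e] times the length. *)
Lemma abs_continuous_le (a b : R) (F : R -> R) : a <= b ->
  abs_continuous a b F ->
  (\forall t \ae mu, t \in `[a, b] -> forall e, 0 < e -> exists2 r : R, 0 < r &
     forall u v, u <= t -> t <= v -> v - u < r -> - (e * (v - u)) <= F v - F u) ->
  F a <= F b.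
Proof.
move=> ab acF [N [mN N0 sN]]; rewrite -subr_ge0.
(* The allowed loss is [e (b - a)] from the ordinary intervals plus [e] from those covering the
   exceptional set. *)
suff h e : 0 < e -> - (e * (b - a + 1)) <= F b - F a.
  apply/ler_addgt0Pr => e e0.
  have k0 : 0 < b - a + 1 by rewrite ltr_wpDl // subr_ge0.
  have := h _ (divr_gt0 e0 k0); rewrite divfK ?gt_eqF //; lra.
move=> e0; have [dl dl0 acd] := acF e e0.
have Noo : (mu N < +oo)%E by rewrite (N0 : mu N = 0%E) ltry.
have [U [oU NU Ud]] := lebesgue_regularity_outer mN Noo dl0.
have mU : measurable U by exact: open_measurable.
have {}Ud : (mu U < dl%:E)%E.
  have -> : (mu U = mu N + mu (U `\` N))%E.
    by rewrite -{1}(setDUK NU); apply: measureU => //; [exact: measurableD|exact: setDIK].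
  by rewrite N0 add0e.
(* The intervals [[p i, q i[] record the pieces of the subdivision that lie in [U]; the variation of
   [F] over them is paid for only at the end, by absolute continuity. *)
pose S u v := exists n (p q : 'I_n -> R),
  [/\ forall i, [/\ u <= p i, p i <= q i & q i <= v],
      forall i j, i != j -> q i <= p j \/ q j <= p i,
      forall i, `[p i, q i[ `<=` U &
      - (e * (v - u)) - \sum_i `|F (q i) - F (p i)| <= F v - F u].
have : S a b.
  apply: interval_additive => //.
  - move=> x y z _ xy yz _ [n [p [q [pq dpq pqU h]]]] [m [p' [q' [pq' dpq' pqU' h']]]].
    exists (n + m)%N.
    exists (fun k : 'I_(n + m) => match fintype.split k with inl i => p i | inr j => p' j end).
    exists (fun k : 'I_(n + m) => match fintype.split k with inl i => q i | inr j => q' j end).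
    split.
    + move=> k; case: (fintype.split k) => i.
        by have [h1 h2 h3] := pq i; split=> //; exact: le_trans yz.
      by have [h1 h2 h3] := pq' i; split=> //; exact: le_trans h1.
    + move=> k l; rewrite -(inj_eq (can_inj (@splitK n m))).
      case: (fintype.split k) (fintype.split l) => i [] j ij.
      * by apply: dpq; apply: contra ij => /eqP ->.
      * by left; have [_ _ h1] := pq i; have [h2 _ _] := pq' j; exact: le_trans h2.
      * by right; have [_ _ h1] := pq j; have [h2 _ _] := pq' i; exact: le_trans h2.
      * by apply: dpq'; apply: contra ij => /eqP ->.
    + by move=> k; case: (fintype.split k) => i.
    + rewrite big_split_ord /=.
      under eq_bigr do rewrite (unsplitK (inl _)).
      under [X in _ - (_ + X)]eq_bigr do rewrite (unsplitK (inr _)).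
      by move: h h'; lra.
  (* Around a point of [N] the interval lies in [U] and is itself the recorded piece; around any
     other point nothing is recorded and the local hypothesis applies. *)
  - move=> t at_ tb; have [Nt|Nt] := pselect (N t).
      have /nbhs_ballP[r /= r0 rU] : nbhs t U by apply: open_nbhs_nbhs; split; last exact: NU.
      exists r => // u v _ ut tv _ uv.
      exists 1%N, (fun=> u), (fun=> v); split=> //.
      + by move=> _; split=> //; exact: le_trans tv.
      + by move=> i j; rewrite !ord1.
      + move=> _ x /=; rewrite in_itv /= => /andP[ux xv]; apply: rU.
        by rewrite /ball /= ltr_norml; apply/andP; split; move: ut tv uv ux xv; lra.
      rewrite big_ord1; have := ler_norm (F u - F v); rewrite distrC.
      have : 0 <= e * (v - u) by rewrite mulr_ge0 ?subr_ge0 ?(ltW e0) // (le_trans ut).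
      by lra.
    have : (t \in `[a, b] -> forall e, 0 < e -> exists2 r : R, 0 < r &
     forall u v, u <= t -> t <= v -> v - u < r -> - (e * (v - u)) <= F v - F u).
      by apply: contrapT => /sN.
    rewrite in_itv /= at_ tb => /(_ isT e e0)[r r0 h]; exists r => // u v _ ut tv _ uv.
    exists 0%N, (fun=> 0), (fun=> 0); split; try by case.
    by rewrite big_ord0 subr0; exact: h.
move=> [n [p [q [pq dpq pqU h]]]].
have hs : \sum_i (q i - p i) < dl.
  by apply: (total_length_lt mU Ud) => // i; have [] := pq i.
have : \sum_i `|F (q i) - F (p i)| < e.
  by apply: acd => // i; have [] := pq i.
by move: h; lra.
Qed.

End AbsolutelyContinuous.

(** * Real primitives: absolute continuity and a prescribed derivative almost everywhere *)

Section Primitives.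
Context {R : realType}.
Notation mu := (@lebesgue_measure R).
Implicit Types (F G f g : R -> R).

Definition primitive_on (a b : R) F f :=
  abs_continuous a b F /\
  \forall t \ae mu, t \in `[a, b] -> is_derive t 1 F (f t).

(** The increment is split at [t], so that the two endpoints may vary independently on either side;
    this is the local hypothesis of [abs_continuous_le]. *)
Lemma is_derive_straddle F (t l e : R) : is_derive t 1 F l -> 0 < e ->
  exists2 r : R, 0 < r &
    forall u v, u <= t -> t <= v -> v - u < r -> (l - e) * (v - u) <= F v - F u.
Proof.
move=> [dF <-] e0.
have /cvgrPdist_le /(_ e e0)/= [r /= r0 rP] := dF.
have h1 h : h != 0 -> `|h| < r -> 'D_1 F t - e <= h^-1 * (F (h + t) - F t).
  move=> h0 hr.
  have : `|'D_1 F t - h^-1 *: (F (h *: 1 + t) - F t)| <= e.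
    by apply: rP => //=; rewrite sub0r normrN.
  rewrite ler_norml (_ : h *: 1 = h) /GRing.scale /= ?mulr1 // => /andP[_].
  by lra.
exists r => // u v ut tv uvr.
have hv : ('D_1 F t - e) * (v - t) <= F v - F t.
  have [->|vt] := eqVneq v t; first by rewrite !subrr mulr0.
  have vt0 : 0 < v - t by rewrite subr_gt0 lt_def vt.
  have := h1 (v - t); rewrite subr_eq0 vt subrK ger0_norm ?(ltW vt0) // => /(_ isT).
  have -> : v - t < r by move: ut tv uvr; lra.
  by move=> /(_ isT); rewrite ler_pdivlMl // [_ * ('D_1 F t - e)]mulrC.
have hu : ('D_1 F t - e) * (t - u) <= F t - F u.
  have [->|tu] := eqVneq u t; first by rewrite !subrr mulr0.
  have tu0 : 0 < t - u by rewrite subr_gt0 lt_def eq_sym tu.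
  have := h1 (u - t); rewrite subr_eq0 tu subrK ler0_norm ?opprB; last first.
    by rewrite -opprB oppr_le0 ltW.
  have -> : t - u < r by move: ut tv uvr; lra.
  move=> /(_ isT isT); rewrite -[u - t]opprB invrN mulNr -mulrN opprB.
  by rewrite ler_pdivlMl // [_ * ('D_1 F t - e)]mulrC.
by move: hu hv; lra.
Qed.

Lemma primitive_on_le a b F f : a <= b -> primitive_on a b F f ->
  (\forall t \ae mu, t \in `[a, b] -> 0 <= f t) -> F a <= F b.
Proof.
move=> ab [acF dF] f0; apply: abs_continuous_le => //.
near=> t => tab e e0.
have ft0 : 0 <= f t by apply: (near f0 t).
have dFt : is_derive t 1 F (f t) by apply: (near dF t).
have [r r0 h] := is_derive_straddle dFt e0.
exists r => // u v ut tv uv; apply: le_trans (h u v ut tv uv).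
rewrite -mulNr ler_wpM2r ?subr_ge0 ?(le_trans ut) // lerDr //.
Unshelve. all: by end_near. Qed.

Lemma abs_continuousS (V : normedModType R) a b c e (F : R -> V) : a <= c -> e <= b ->
  abs_continuous a b F -> abs_continuous c e F.
Proof.
move=> ac eb acF k /acF[dl dl0 h]; exists dl => // n u v uv; apply: h => i.
by have [h1 [h2 h3]] := uv i; split; [exact: le_trans h1|split=> //; exact: le_trans eb].
Qed.

Lemma primitive_onS a b c e F f : a <= c -> e <= b ->
  primitive_on a b F f -> primitive_on c e F f.
Proof.
move=> ac eb [acF dF]; split; first exact: abs_continuousS acF.
apply: filterS dF => t h /[!in_itv]/= /andP[ct te]; apply: h.
by rewrite in_itv /= (le_trans ac) // (le_trans te).
Qed.

Lemma eq_primitive_on a b F f g :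
  (\forall t \ae mu, t \in `[a, b] -> f t = g t) ->
  primitive_on a b F f -> primitive_on a b F g.
Proof.
move=> fg [acF dF]; split=> //; apply: filterS2 fg dF => t h1 h2 tab.
by rewrite -h1 //; exact: h2.
Qed.

Lemma primitive_onD a b F G f g : primitive_on a b F f -> primitive_on a b G g ->
  primitive_on a b (fun t => F t + G t) (fun t => f t + g t).
Proof.
move=> [acF dF] [acG dG]; split; last first.
  by apply: filterS2 dF dG => t hF hG tab; apply: is_deriveD; [exact: hF|exact: hG].
move=> e e0; have e2 : 0 < e / 2 by rewrite divr_gt0.
have [d1 d10 h1] := acF _ e2; have [d2 d20 h2] := acG _ e2.
exists (Num.min d1 d2); first by rewrite lt_min d10.
move=> n u v uv dis; rewrite lt_min => /andP[l1 l2].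
rewrite (splitr e); apply: le_lt_trans (ltrD (h1 _ _ _ uv dis l1) (h2 _ _ _ uv dis l2)).
rewrite -big_split /=; apply: ler_sum => i _.
by rewrite opprD addrACA ler_normD.
Qed.

Lemma primitive_onZ a b (k : R) F f : primitive_on a b F f ->
  primitive_on a b (fun t => k * F t) (fun t => k * f t).
Proof.
move=> [acF dF]; split; last first.
  by apply: filterS dF => t hF tab; apply: is_deriveZ; exact: hF.
move=> e e0; have k0 : 0 < `|k| + 1 by rewrite ltr_wpDl.
have [dl dl0 h] := acF _ (divr_gt0 e0 k0); exists dl => // n u v uv dis l.
have := h _ _ _ uv dis l; rewrite ltr_pdivlMr // => /(le_lt_trans _); apply.
rewrite mulr_suml; apply: ler_sum => i _.
by rewrite -mulrBr normrM mulrC ler_wpM2l // lerDl.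
Qed.

Lemma abs_continuous_lipschitz (V : normedModType R) a b (c : R) (F : R -> V) :
  (forall u v, a <= u -> u <= v -> v <= b -> `|F v - F u| <= c * (v - u)) ->
  abs_continuous a b F.
Proof.
move=> lipF e e0; pose k := `|c| + 1; have k0 : 0 < k by rewrite ltr_wpDl.
exists (e / k) => [|n u v uv _]; first by rewrite divr_gt0.
rewrite ltr_pdivlMr // => /(le_lt_trans _); apply.
rewrite mulr_suml; apply: ler_sum => i _; have [h1 [h2 h3]] := uv i.
rewrite (le_trans (lipF _ _ h1 h2 h3)) // mulrC ler_wpM2l ?subr_ge0 //.
by rewrite (le_trans (ler_norm c)) // lerDl.
Qed.

Lemma primitive_on_cst a b (k : R) : primitive_on a b (fun=> k) (fun=> 0).
Proof.
split; last by apply: aeW => t _; exact: is_derive_cst.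
apply: (@abs_continuous_lipschitz _ _ _ 0) => u v _ _ _.
by rewrite subrr normr0 mul0r.
Qed.

Lemma primitive_onB a b F G f g : primitive_on a b F f -> primitive_on a b G g ->
  primitive_on a b (fun t => F t - G t) (fun t => f t - g t).
Proof.
move=> pF pG; have := primitive_onD pF (primitive_onZ (-1) pG).
under eq_fun do rewrite mulN1r.
by under [X in primitive_on _ _ _ X -> _]eq_fun do rewrite mulN1r.
Qed.

Lemma primitive_on_sum a b n (F f : 'I_n -> R -> R) :
  (forall i, primitive_on a b (F i) (f i)) ->
  primitive_on a b (fun t => \sum_i F i t) (fun t => \sum_i f i t).
Proof.
elim: n F f => [|n IH] F f h.
  under eq_fun do rewrite big_ord0.
  under [X in primitive_on _ _ _ X]eq_fun do rewrite big_ord0.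
  exact: primitive_on_cst.
under eq_fun do rewrite big_ord_recr.
under [X in primitive_on _ _ _ X]eq_fun do rewrite big_ord_recr.
by apply: primitive_onD => //; apply: IH.
Qed.

Lemma primitive_on_expR a b (k c : R) : 0 <= k -> 
  primitive_on a b (fun t => expR (k * (c - t))) (fun t => - k * expR (k * (c - t))).
Proof.
move=> k0.
have dE (t : R) : is_derive t (1 : R) (fun t => expR (k * (c - t))) (- k * expR (k * (c - t))).
  by apply: is_derive_eq; rewrite /GRing.scale /=; ring.
split; last by apply: aeW.
apply: (@abs_continuous_lipschitz _ _ _ (k * expR (k * (c - a)))) => u v au uv vb.
have [x xuv ->] := @MVT_segment R (fun t => expR (k * (c - t)))
  (fun t => - k * expR (k * (c - t))) u v uv (fun x _ => dE x)
  (derivable_within_continuous (fun x _ => @ex_derive _ _ _ _ _ _ _ (dE x))).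
have x0 := expR_ge0 (k * (c - x)).
rewrite !normrM normrN (ger0_norm k0) (ger0_norm x0) ger0_norm ?subr_ge0 //.
move: xuv; rewrite in_itv /= => /andP[ux _].
rewrite ler_wpM2r ?subr_ge0 // ler_wpM2l // ler_expR ler_wpM2l //.
by rewrite lerB // (le_trans au).
Qed.

(** The primitive is a Lebesgue integral; it is Lipschitz because the integrand is bounded, and its
    derivative comes from the fundamental theorem of calculus. *)
Lemma primitive_on_exists (a b : R) (f : R -> R) (c g0 : R) : a < b ->
  measurable_fun (`[a, b]%classic : set R) f ->
  (\forall t \ae mu, t \in `[a, b] -> `|f t| <= c) ->
  exists2 F, primitive_on a b F f & F b = g0.
Proof.
move=> ab mf fc.
(* Truncation at [|c|] alters [f] on [[a, b]] only on a null set and makes the bound hold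
   everywhere; extension by zero then makes [f1] integrable on the whole line. *)
pose f2 t := Num.max (- `|c|) (Num.min `|c| (f t)).
have f2c t : `|f2 t| <= `|c|.
  by rewrite /f2 ler_norml le_max lexx /= ge_max ge_min lexx ge0_cp.
pose f1 := f2 \_ `[a, b]%classic.
have f1c t : `|f1 t| <= `|c|.
  by rewrite /f1 patchE; case: ifP => _; rewrite ?normr0.
have mf2 : measurable_fun (`[a, b]%classic : set R) f2.
  by apply: measurable_maxr => //; exact: measurable_minr.
have if1 : mu.-integrable setT (EFin \o f1).
  suff if2 : mu.-integrable `[a, b]%classic (EFin \o f2).
    by rewrite -restrict_EFin; apply/(integrable_mkcond _ _).1.
  apply: measurable_bounded_integrable => //.
    by rewrite /= lebesgue_measure_itv /= lte_fin ab -EFinB ltry.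
  exists `|c|; split; first exact: num_real.
  by move=> x cx t _ /=; apply: le_trans (f2c t) (ltW cx).
pose F x := (\int[mu]_(t in `]-oo, x]) f1 t)%R.
have lipF u v : u <= v -> `|F v - F u| <= `|c| * (v - u).
  move=> uv; rewrite /F Rintegral_itvB ?bnd_simp //; last first.
    by apply: integrableS if1.
  have muv : mu `]u, v] = (v - u)%:E.
    by rewrite lebesgue_measure_itv /= lte_fin; case: ltgtP uv => // ->; rewrite subrr.
  apply: le_trans (le_normr_Rintegral _ _) _ => //; first by apply: integrableS if1.
  apply: (@le_trans _ _ (\int[mu]_(t in `]u, v]) `|c|)%R).
    apply: le_Rintegral => //.
    - by apply: integrable_norm; apply: integrableS if1.
    - apply: measurable_bounded_integrable => //.
        by have := muv; rewrite /= => ->; rewrite ltry.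
      exists `|c|; split; first exact: num_real.
      by move=> x cx t _ /=; rewrite normr_id ltW.
  by rewrite Rintegral_cst //= muv.
have dF : {ae mu, forall x, derivable F x 1 /\ derive1 F x = f1 x}.
  apply: FTC1Ny => [y|]; first by apply: integrableS if1.
  by apply: open_integrable_locally => //; exact: openT.
exists (fun t => F t - F b + g0); last by rewrite subrr add0r.
suff pF : primitive_on a b F f.
  apply: eq_primitive_on (primitive_onD (primitive_onD pF (primitive_on_cst a b (- F b)))
    (primitive_on_cst a b g0)).
  by apply: aeW => t _; rewrite !addr0.
split; first by apply: abs_continuous_lipschitz => u v _ uv _; exact: lipF.
apply: filterS2 dF fc => t [dFt Ft] ft tab.
split=> //; rewrite -derive1E Ft /f1 patchE mem_set //; move: (ft tab).
rewrite ler_norml /f2 => /andP[h1 h2]; have := ler_norm c => h3.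
rewrite min_r ?max_r //; lra.
Qed.

End Primitives.

(** * Bounded measurable and continuous matrix functions *)

Section MatrixFunctions.
Context {R : realType} (d : nat) (T : R).
Hypothesis T_gt0 : 0 < T.
Notation mu := (@lebesgue_measure R).
Implicit Types (F G f g X Y : R -> 'M[R]_d).

Lemma expR_ge1 (x : R) : (1 <= expR x) = (0 <= x).
Proof. by rewrite -[leLHS]expR0 ler_expR. Qed.

Lemma within_continuousP (a b : R) (f : R -> R) :
  {within `[a, b], continuous f} <->
  forall t : R, t \in `[a, b] -> forall e, 0 < e -> exists2 r : R, 0 < r &
    forall s : R, s \in `[a, b] -> `|t - s| < r -> `|f t - f s| <= e.
Proof.
split=> [cf t tab e e0|h].
  have tA : [set` `[a, b]] t by [].
  have h := (cvgrPdist_le _ _).1 (cf t) e e0.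
  have {h} : within `[a, b] (nbhs t) (fun s => `|f t - f s| <= e).
    by rewrite (nbhs_subspace_in tA); exact: h.
  move=> /nbhs_ballP[r /= r0 rP].
  by exists r => // s sab ts; exact: rP.
rewrite continuous_subspace_in => t /set_mem tab; apply/cvgrPdist_le => e e0.
have tA : [set` `[a, b]] t by [].
have [r r0 rP] := h t tab e e0.
suff h' : within `[a, b] (nbhs t) (fun s => `|f t - f s| <= e).
  by rewrite (nbhs_subspace_in tA) in h'; exact: h'.
by apply/nbhs_ballP; exists r => //= s ts sab; exact: rP.
Qed.

(** Entrywise, so that sums and products reduce to the scalar case; [mcontinuousP] is the equivalent
    statement in norm. *)
Definition mcontinuous F :=
  forall i j, {within `[0, T], continuous (fun t => F t i j)}.

Lemma within_mcontinuous F : {within `[0, T], continuous F} -> mcontinuous F.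
Proof.
move=> cF i j x; apply: (@cvg_comp _ _ _ F (fun M : 'M[R]_d => M i j)); first exact: cF.
exact: coord_continuous.
Qed.

Lemma mcontinuousP F : mcontinuous F <->
  forall t : R, t \in `[0, T] -> forall e, 0 < e -> exists2 r : R, 0 < r &
    forall s : R, s \in `[0, T] -> `|t - s| < r -> `|F t - F s| <= e.
Proof.
split=> [cF t tT e e0|h i j]; last first.
  apply/within_continuousP => t tT e e0; have [r r0 rP] := h t tT e e0.
  exists r => // s sT ts; apply: le_trans (rP s sT ts).
  by have := le_mxnorm (F t - F s) i j; rewrite !mxE.
have h (ij : 'I_d * 'I_d) : exists r : R, 0 < r /\
    forall s : R, s \in `[0, T] -> `|t - s| < r -> `|F t ij.1 ij.2 - F s ij.1 ij.2| <= e.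
  by have /within_continuousP/(_ t tT e e0)[r r0 rP] := cF ij.1 ij.2; exists r.
have {h}[r rP] := choice h.
exists (\big[Num.min/1]_ij r ij).
  by apply: lt_bigmin => // ij _; have [] := rP ij.
move=> s sT ts; apply: mxnorm_le => [|i j]; first exact: ltW.
rewrite !mxE; have [_] := rP (i, j); apply => //.
by apply: lt_le_trans ts _; exact: bigmin_le.
Qed.

Lemma mcontinuousM F G : mcontinuous F -> mcontinuous G ->
  mcontinuous (fun t => F t *m G t).
Proof.
move=> cF cG i j.
have -> : (fun t => (F t *m G t) i j) = (fun t => \sum_k F t i k * G t k j).
  by apply/funext => t; rewrite mxE.
elim: (index_enum _) => [|k s IH].
  rewrite (_ : (fun _ => _) = fun=> 0); first by move=> x; exact: cvg_cst.
  by apply/funext => t; rewrite big_nil.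
rewrite (_ : (fun _ => _) =
  fun t => F t i k * G t k j + \sum_(l <- s) F t i l * G t l j); last first.
  by apply/funext => t; rewrite big_cons.
by move=> x; apply: cvgD; [apply: cvgM; [exact: cF|exact: cG] | exact: IH].
Qed.

Lemma mcontinuousD F G : mcontinuous F -> mcontinuous G ->
  mcontinuous (fun t => F t + G t).
Proof.
move=> cF cG i j.
have -> : (fun t => (F t + G t) i j) = (fun t => F t i j + G t i j).
  by apply/funext => t; rewrite mxE.
by move=> x; apply: cvgD; [exact: cF | exact: cG].
Qed.

Lemma mcontinuousN F : mcontinuous F -> mcontinuous (fun t => - F t).
Proof.
move=> cF i j.
have -> : (fun t => (- F t) i j) = (fun t => - F t i j).
  by apply/funext => t; rewrite mxE.
by move=> x; apply: cvgN; exact: cF.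
Qed.

Lemma mcontinuous_tr F : mcontinuous F -> mcontinuous (fun t => (F t)^T).
Proof.
move=> cF i j; have -> : (fun t => (F t)^T i j) = (fun t => F t j i).
  by apply/funext => t; rewrite mxE.
exact: cF.
Qed.

Lemma mcontinuous_cst (M : 'M[R]_d) : mcontinuous (fun=> M).
Proof. by move=> i j x; exact: cvg_cst. Qed.

Lemma mcontinuous_bounded F : mcontinuous F ->
  exists2 c, 0 <= c & forall t, t \in `[0, T] -> `|F t| <= c.
Proof.
move=> /mcontinuousP cF.
pose S u v := exists2 c, 0 <= c & forall t, t \in `[u, v] -> `|F t| <= c.
apply: (@interval_additive _ 0 T S (ltW T_gt0)) =>
  [x y z _ xy yz _ [c c0 hc] [e e0 he]|t t0 tT].
  exists (Num.max c e) => [|t]; first by rewrite le_max c0.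
  rewrite in_itv /= => /andP[xt tz]; rewrite le_max; case: (leP t y) => ty.
    by rewrite hc // in_itv /= xt.
  by rewrite he ?orbT // in_itv /= tz ltW.
have [|r r0 rP] := cF t _ _ ltr01; first by rewrite in_itv /= t0.
exists r => // u v u0 ut tv vT uvr; exists (`|F t| + 1); first by rewrite addr_ge0.
move=> s; rewrite in_itv /= => /andP[us sv].
have sT : s \in `[0, T] by rewrite in_itv /= (le_trans u0) // (le_trans sv).
have h := rP s sT; rewrite -[F s](subrK (F t)).
rewrite (le_trans (ler_normD _ _)) // addrC lerD2l distrC h //.
by rewrite ltr_norml; apply/andP; split; move: uvr ut tv us sv; lra.
Qed.

Lemma Linfty_mcontinuous F : mcontinuous F -> Linfty T F.
Proof.
move=> cF; split=> [i j|].
  exact: (subspace_continuous_measurable_fun (measurable_itv _) (cF i j)).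
by have [c _ h] := mcontinuous_bounded cF; exists c; apply: aeW.
Qed.

Lemma Linfty_bound F : Linfty T F -> exists2 c, 0 <= c &
  \forall t \ae mu, t \in `[0, T] -> `|F t| <= c.
Proof.
move=> [_ [c h]]; exists `|c| => //; apply: filterS h => t h tT.
exact: le_trans (h tT) (ler_norm c).
Qed.

Lemma LinftyM F G : Linfty T F -> Linfty T G -> Linfty T (fun t => F t *m G t).
Proof.
move=> LF LG; have [c c0 hc] := Linfty_bound LF; have [e e0 he] := Linfty_bound LG.
case: LF LG => mF _ [mG _]; split=> [i j|].
  have -> : (fun t => (F t *m G t) i j) = (fun t => \sum_k F t i k * G t k j).
    by apply/funext => t; rewrite mxE.
  by apply: measurable_sum => k; apply: measurable_funM.
exists (d%:R * (c * e)); apply: filterS2 hc he => t h1 h2 tT.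
rewrite (le_trans (mxnorm_mul _ _)) // ler_wpM2l // ler_pM //; [exact: h1|exact: h2].
Qed.

Lemma LinftyD F G : Linfty T F -> Linfty T G -> Linfty T (fun t => F t + G t).
Proof.
move=> [mF [c hc]] [mG [e he]]; split=> [i j|].
  have -> : (fun t => (F t + G t) i j) = (fun t => F t i j + G t i j).
    by apply/funext => t; rewrite mxE.
  exact: measurable_funD.
exists (c + e); apply: filterS2 hc he => t h1 h2 tT.
by rewrite (le_trans (ler_normD _ _)) // lerD //; [exact: h1|exact: h2].
Qed.

Lemma LinftyZ k F : Linfty T F -> Linfty T (fun t => k *: F t).
Proof.
move=> [mF [c hc]]; split=> [i j|].
  have -> : (fun t => (k *: F t) i j) = (fun t => k * F t i j).
    by apply/funext => t; rewrite mxE.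
  exact: measurable_funM.
exists (`|k| * c); apply: filterS hc => t h tT.
by rewrite normrZ ler_wpM2l //; exact: h.
Qed.

Lemma LinftyN F : Linfty T F -> Linfty T (fun t => - F t).
Proof. by move=> LF; under eq_fun do rewrite -scaleN1r; exact: LinftyZ. Qed.

Lemma LinftyB F G : Linfty T F -> Linfty T G -> Linfty T (fun t => F t - G t).
Proof. by move=> LF LG; apply: LinftyD => //; exact: LinftyN. Qed.

Lemma Linfty_tr F : Linfty T F -> Linfty T (fun t => (F t)^T).
Proof.
move=> [mF [c hc]]; split=> [i j|].
  have -> // : (fun t => (F t)^T i j) = (fun t => F t j i).
  by apply/funext => t; rewrite mxE.
by exists c; apply: filterS hc => t h tT; rewrite mxnorm_tr; exact: h.
Qed.

(** * Matrix primitives, taken entrywise *)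

Definition mprimitive F f := forall i j,
  primitive_on 0 T (fun t => F t i j) (fun t => f t i j).

Lemma eq_mprimitive F f g :
  (\forall t \ae mu, t \in `[0, T] -> f t = g t) ->
  mprimitive F f -> mprimitive F g.
Proof.
move=> fg pF i j; apply: eq_primitive_on (pF i j).
by apply: filterS fg => t h tT; rewrite h.
Qed.

Lemma mprimitiveD F G f g : mprimitive F f -> mprimitive G g ->
  mprimitive (fun t => F t + G t) (fun t => f t + g t).
Proof.
move=> pF pG i j; under eq_fun do rewrite mxE.
under [X in primitive_on _ _ _ X]eq_fun do rewrite mxE.
exact: primitive_onD.
Qed.

Lemma mprimitiveZ k F f : mprimitive F f ->
  mprimitive (fun t => k *: F t) (fun t => k *: f t).
Proof.
move=> pF i j; under eq_fun do rewrite mxE.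
under [X in primitive_on _ _ _ X]eq_fun do rewrite mxE.
exact: primitive_onZ.
Qed.

Lemma mprimitiveB F G f g : mprimitive F f -> mprimitive G g ->
  mprimitive (fun t => F t - G t) (fun t => f t - g t).
Proof.
move=> pF pG; have := mprimitiveD pF (mprimitiveZ (-1) pG).
under eq_fun do rewrite scaleN1r.
by under [X in mprimitive _ X -> _]eq_fun do rewrite scaleN1r.
Qed.

Lemma mprimitive_tr F f : mprimitive F f ->
  mprimitive (fun t => (F t)^T) (fun t => (f t)^T).
Proof.
move=> pF i j; under eq_fun do rewrite mxE.
by under [X in primitive_on _ _ _ X]eq_fun do rewrite mxE.
Qed.

Lemma mprimitive_exists f (M : 'M[R]_d) : Linfty T f ->
  exists2 F, mprimitive F f & F T = M.
Proof.
move=> [mf [c hc]].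
have h (ij : 'I_d * 'I_d) : exists F : R -> R, primitive_on 0 T F (fun t => f t ij.1 ij.2) /\
    F T = M ij.1 ij.2.
  have [|F pF FT] := @primitive_on_exists R 0 T _ c (M ij.1 ij.2) T_gt0 (mf ij.1 ij.2).
    by apply: filterS hc => t h tT; apply: le_trans (h tT); exact: le_mxnorm.
  by exists F.
have [F FP] := choice h.
exists (fun t => \matrix_(i, j) F (i, j) t).
  by move=> i j; have [p _] := FP (i, j); under eq_fun do rewrite mxE.
by apply/matrixP => i j; rewrite mxE; have [_] := FP (i, j).
Qed.

Lemma mprimitive_mcontinuous F f : mprimitive F f -> mcontinuous F.
Proof.
move=> pF i j; apply/within_continuousP => t tT e e0.
have [acF _] := pF i j; have [r r0 rP] := acF e e0; exists r => // s sT ts.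
have h u v : u \in `[0, T] -> v \in `[0, T] -> u <= v -> v - u < r ->
    `|F v i j - F u i j| <= e.
  rewrite !in_itv /= => /andP[u0 uT] /andP[v0 vT] uv uvr.
  have := rP 1%N (fun=> u) (fun=> v); rewrite !big_ord1 => /(_ _ _ uvr) hh.
  by apply/ltW/hh => // k l; rewrite !ord1.
have [st|ts'] := leP s t; first by apply: h => //; move: ts; rewrite ltr_norml => /andP[].
by rewrite distrC; apply: h => //; [exact: ltW|move: ts; rewrite ltr_norml; lra].
Qed.

(** * Gronwall estimates and geometric convergence of iterations *)

Lemma primitive_weighted_bound (a m : R) X f : 0 < a -> 0 <= m ->
  mprimitive X f -> X T = 0 ->
  (\forall t \ae mu, t \in `[0, T] -> `|f t| <= a * (m * expR (a * (T - t)))) ->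
  forall t, t \in `[0, T] -> `|X t| <= m * expR (a * (T - t)).
Proof.
move=> a0 m0 pX XT hf t; rewrite in_itv /= => /andP[t0 tT].
apply: mxnorm_le => [|i j]; first by rewrite mulr_ge0 // expR_ge0.
have pE := primitive_onZ m (primitive_on_expR t T T (ltW a0)).
have pXij := primitive_onS t0 (lexx T) (pX i j).
have hs : \forall s \ae mu, s \in `[t, T] -> `|f s i j| <= a * (m * expR (a * (T - s))).
  apply: filterS hf => s h; rewrite in_itv /= => /andP[ts sT].
  by apply: le_trans (le_mxnorm _ _ _) (h _); rewrite in_itv /= (le_trans t0).
have XT0 : X T i j = 0 by rewrite XT mxE.
have E1 : m * expR (a * (T - T)) = m by rewrite subrr mulr0 expR0 mulr1.
have mE : 0 <= m * expR (a * (T - t)) by rewrite mulr_ge0 // expR_ge0.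
(* For either sign, [m * expR (a * (T - t))] plus or minus an entry of [X] is nonincreasing, and it
   equals [m >= 0] at [T]. *)
rewrite ler_norml; apply/andP; split.
  have := primitive_on_le tT (primitive_onB (primitive_onZ (-1) pE) pXij).
  rewrite E1 XT0 => /(_ _)h.
  have : -1 * (m * expR (a * (T - t))) - X t i j <= -1 * m - 0.
    apply: h; apply: filterS hs => s hs sT; have := hs sT.
    by rewrite ler_norml => /andP[]; lra.
  by move: m0; lra.
have := primitive_on_le tT (primitive_onB (primitive_onZ (-1) pE)
  (primitive_onZ (-1) pXij)).
rewrite E1 XT0 => /(_ _)h.
have : -1 * (m * expR (a * (T - t))) - -1 * X t i j <= -1 * m - -1 * 0.
  apply: h; apply: filterS hs => s hs sT; have := hs sT.
  by rewrite ler_norml => /andP[]; lra.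
by move: m0; lra.
Qed.

(* The weight [expR (3 * a * (T - t))] makes the Lipschitz estimate a contraction by [1/2]. *)
Lemma gronwall_halving (a m : R) X f : 0 < a -> 0 <= m ->
  mprimitive X f -> X T = 0 ->
  (\forall t \ae mu, t \in `[0, T] ->
     `|f t| <= a * (`|X t| + m * expR (3 * a * (T - t)))) ->
  forall t, t \in `[0, T] -> `|X t| <= m / 2 * expR (3 * a * (T - t)).
Proof.
move=> a0 m0 pX XT hf.
have a30 : 0 < 3 * a by rewrite mulr_gt0.
have phi_gt0 t : 0 < expR (3 * a * (T - t)) by exact: expR_gt0.
(* The hypothesis bounds [f] by [a (M + m)] times the weight, that is, by the rate [3 a] of the
   weight times [(M + m) / 3]. *)
have step M : 0 <= M ->
    (forall t, t \in `[0, T] -> `|X t| <= M * expR (3 * a * (T - t))) ->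
    forall t, t \in `[0, T] -> `|X t| <= (M + m) / 3 * expR (3 * a * (T - t)).
  move=> M0 hM; apply: (primitive_weighted_bound a30 _ pX XT).
    by rewrite divr_ge0 ?addr_ge0.
  apply: filterS hf => t hf tT; apply: le_trans (hf tT) _.
  have := hM t tT; have := phi_gt0 t; set p := expR _ => p0.
  rewrite (_ : 3 * a * _ = a * ((M + m) * p)); last by field.
  by rewrite ler_pM2l //; lra.
pose E := [set `|X t| / expR (3 * a * (T - t)) | t in [set t | t \in `[0, T]]].
have T_in : T \in `[0, T] by rewrite in_itv /= lexx ltW.
have E0 : E 0 by exists T => //; rewrite XT normr0 mul0r.
have supE : has_sup E.
  split; first by exists 0.
  have [c c0 hc] := mcontinuous_bounded (mprimitive_mcontinuous pX).
  exists c => _ [t tT <-]; rewrite ler_pdivrMr //.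
  apply: le_trans (hc t tT) _; rewrite ler_peMr // expR_ge1.
  by move: tT; rewrite /= in_itv /= => /andP[_ tT]; rewrite mulr_ge0 ?subr_ge0 // ltW.
pose M := sup E.
have M0 : 0 <= M by apply: sup_upper_bound.
have hM t : t \in `[0, T] -> `|X t| <= M * expR (3 * a * (T - t)).
  by move=> tT; rewrite -ler_pdivrMr //; apply: sup_upper_bound => //; exists t.
(* The best constant [M] cannot be improved by [step], so [M <= m / 2]. *)
have M3 : M <= (M + m) / 3.
  apply: ge_sup; first by exists 0.
  by move=> _ [t tT <-]; rewrite ler_pdivrMr //; exact: step.
move=> t tT; apply: le_trans (hM t tT) _.
by rewrite ler_pM2r //; move: M3; lra.
Qed.

(** A positive [x] would bound [2 ^+ k] by [c / x] for all [k], against the Archimedean property and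
    [k < 2 ^ k]. *)
Lemma le0_geometric (x c : R) : (forall k, x <= c / 2 ^+ k) -> x <= 0.
Proof.
move=> h; rewrite leNgt; apply/negP => x0.
have c0 : 0 < c by have := h 0%N; rewrite expr0 divr1; exact: lt_le_trans.
have := h (Num.bound (c / x)); rewrite ler_pdivlMr ?exprn_gt0 //.
apply/negP; rewrite -ltNge -ltr_pdivrMl // mulrC.
apply: lt_trans (_ : (Num.bound (c / x))%:R < _).
  by rewrite archi_boundP // divr_ge0 ?ltW.
by rewrite -natrX ltr_nat ltn_expl.
Qed.

(** The intervals of center [u k] and radius [2 c / 2 ^+ k] are nested; the supremum of their left
    ends lies in all of them, which also gives the rate. *)
Lemma geometric_limit (u : nat -> R) (c : R) :
  (forall k, `|u k.+1 - u k| <= c / 2 ^+ k) ->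
  exists l, forall k, `|u k - l| <= 2 * c / 2 ^+ k.
Proof.
move=> hu.
have p0 k : (2 : R) ^+ k != 0 by rewrite expf_neq0.
pose l k := u k - 2 * c / 2 ^+ k; pose r k := u k + 2 * c / 2 ^+ k.
have E k : 2 * c / 2 ^+ k = c / 2 ^+ k + 2 * c / 2 ^+ k.+1.
  by rewrite exprS; field; rewrite p0.
have lS k : l k <= l k.+1.
  by have := hu k; rewrite /l (E k) ler_norml => /andP[]; lra.
have rS k : r k.+1 <= r k.
  by have := hu k; rewrite /r (E k) ler_norml => /andP[]; lra.
have c0 : 0 <= c by have := hu 0%N; rewrite expr0 divr1; exact: le_trans.
have lr k : l k <= r k.
  have : 0 <= 2 * c / 2 ^+ k by rewrite divr_ge0 ?exprn_ge0 ?mulr_ge0.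
  by rewrite /l /r; lra.
have lmono : {homo l : i j / (i <= j)%N >-> i <= j}.
  by apply: homo_leq => // x y z; exact: le_trans.
have rmono i j : (i <= j)%N -> r j <= r i.
  elim: j => [|j IH]; first by rewrite leqn0 => /eqP ->.
  rewrite leq_eqVlt => /predU1P[->//|]; rewrite ltnS => /IH; exact: le_trans.
have lrij i j : l i <= r j.
  apply: le_trans (lmono _ _ (leq_maxl i j)) _.
  exact: le_trans (lr _) (rmono _ _ (leq_maxr i j)).
have supl : has_sup (range l).
  by split; [exists (l 0%N), 0%N | exists (r 0%N) => _ [i _ <-]].
exists (sup (range l)) => k.
have h1 : l k <= sup (range l) by apply: sup_upper_bound => //; exists k.
have h2 : sup (range l) <= r k by apply: ge_sup => [|_ [i _ <-]//]; exists (l 0%N), 0%N.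
by rewrite ler_norml; apply/andP; move: h1 h2; rewrite /l /r; lra.
Qed.

Lemma iteration_limit (a : R) (X f : nat -> R -> 'M[R]_d) (G : 'M[R]_d) : 0 < a ->
  (forall k, mprimitive (X k) (f k)) -> (forall k, X k T = G) ->
  (forall k, \forall t \ae mu, t \in `[0, T] ->
    `|f k.+2 t - f k.+1 t| <= a * (`|X k.+2 t - X k.+1 t| + `|X k.+1 t - X k t|)) ->
  exists c L, mcontinuous L /\
    forall k t, t \in `[0, T] -> `|X k t - L t| <= c / 2 ^+ k.
Proof.
move=> a0 pX XT hf.
have cX k := mprimitive_mcontinuous (pX k).
have [m m0 hm] := mcontinuous_bounded (mcontinuousD (cX 1%N) (mcontinuousN (cX 0%N))).
have phi_ge1 t : t \in `[0, T] -> 1 <= expR (3 * a * (T - t)).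
  by rewrite in_itv /= => /andP[_ tT]; rewrite expR_ge1 mulr_ge0 ?subr_ge0 // mulr_ge0 // ltW.
(* In the weighted norm each increment is at most half of the preceding one. *)
have hX k : forall t, t \in `[0, T] ->
    `|X k.+1 t - X k t| <= m / 2 ^+ k * expR (3 * a * (T - t)).
  elim: k => [|k IH] t tT.
    by rewrite expr0 divr1 (le_trans (hm t tT)) // ler_peMr // phi_ge1.
  have -> : m / 2 ^+ k.+1 = m / 2 ^+ k / 2.
    by rewrite exprS; field; rewrite expf_neq0.
  apply: (gronwall_halving a0 _ (mprimitiveB (pX k.+2) (pX k.+1))) => //.
  - by rewrite divr_ge0 ?exprn_ge0.
  - by rewrite !XT subrr.
  apply: filterS (hf k) => s hs sT; apply: le_trans (hs sT) _.
  by rewrite ler_pM2l // lerD2l IH.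
pose c := m * expR (3 * a * T).
have hXc k t : t \in `[0, T] -> `|X k.+1 t - X k t| <= c / 2 ^+ k.
  move=> tT; apply: le_trans (hX k t tT) _.
  rewrite /c [leLHS]mulrAC ler_wpM2r ?invr_ge0 ?exprn_ge0 // ler_wpM2l // ler_expR.
  move: tT; rewrite in_itv /= => /andP[t0 _].
  by rewrite ler_wpM2l ?gerBl // mulr_ge0 // ltW.
have hl (z : 'I_d * 'I_d * R) : exists l : R, z.2 \in `[0, T] ->
    forall k, `|X k z.2 z.1.1 z.1.2 - l| <= 2 * c / 2 ^+ k.
  have [zT|zT] := boolP (z.2 \in `[0, T]); last by exists 0.
  have [k|l hl] := @geometric_limit (fun k => X k z.2 z.1.1 z.1.2) c; last by exists l.
  apply: le_trans (hXc k _ zT).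
  by have := le_mxnorm (X k.+1 z.2 - X k z.2) z.1.1 z.1.2; rewrite !mxE.
have [l lP] := choice hl.
exists (2 * c), (fun t => \matrix_(i, j) l (i, j, t)).
have c0 : 0 <= c by rewrite mulr_ge0 // expR_ge0.
have hL k t : t \in `[0, T] -> `|X k t - \matrix_(i, j) l (i, j, t)| <= 2 * c / 2 ^+ k.
  move=> tT; apply: mxnorm_le => [|i j]; first by rewrite !mulr_ge0 // invr_ge0 exprn_ge0.
  by rewrite !mxE; exact: (lP (i, j, t)).
(* A uniform limit of continuous functions: two approximation errors and one modulus of continuity,
   each at most [e / 3]. *)
split=> //; apply/mcontinuousP => t tT e e0.
have [k hk] : exists k, 2 * c / 2 ^+ k <= e / 3.
  apply: contrapT => nk; have : e / 3 <= 0.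
    apply: (@le0_geometric _ (2 * c)) => k; apply/ltW; rewrite ltNge.
    by apply/negP => h; apply: nk; exists k.
  by move: e0; lra.
have e30 : 0 < e / 3 by rewrite divr_gt0.
have /mcontinuousP/(_ t tT _ e30)[r r0 rP] := cX k.
exists r => // s sT ts; have h1 := hL k t tT; have h2 := hL k s sT; have h3 := rP s sT ts.
move: h1 h2; set Lt := \matrix_(i, j) _; set Ls := \matrix_(i, j) _ => h1 h2.
have -> : Lt - Ls = (X k t - X k s) - (X k t - Lt) + (X k s - Ls).
  by apply/matrixP => i j; rewrite !mxE; ring.
have := ler_normD (X k t - X k s - (X k t - Lt)) (X k s - Ls).
have := ler_normB (X k t - X k s) (X k t - Lt).
lra.
Qed.

(** The primitive [Y] of [g] ending at [G] is also a limit of the iterates, since the derivatives of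
    the differences [X k.+1 - Y] tend to zero; hence [Y] agrees with [L]. *)
Lemma limit_primitive (c K : R) (X f : nat -> R -> 'M[R]_d) (G : 'M[R]_d) L g :
  (forall k, mprimitive (X k) (f k)) -> (forall k, X k T = G) ->
  (forall k t, t \in `[0, T] -> `|X k t - L t| <= c / 2 ^+ k) ->
  Linfty T g ->
  (forall k, \forall t \ae mu, t \in `[0, T] -> `|f k.+1 t - g t| <= K / 2 ^+ k) ->
  exists Y, [/\ mprimitive Y g, Y T = G & forall t, t \in `[0, T] -> Y t = L t].
Proof.
move=> pX XT hL Lg hg.
have [Y pY YT] := mprimitive_exists G Lg; exists Y; split=> // t tT.
apply/eqP; rewrite -subr_eq0 -normr_le0.
have K0 k : 0 <= `|K| / 2 ^+ k by rewrite divr_ge0 ?exprn_ge0.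
have h k : `|X k.+1 t - Y t| <= `|K| / 2 ^+ k * expR (1 * (T - t)).
  apply: (primitive_weighted_bound ltr01 (K0 k) (mprimitiveB (pX k.+1) pY)) => //.
    by rewrite XT YT subrr.
  apply: filterS (hg k) => s hs sT; apply: le_trans (hs sT) _.
  rewrite mul1r mul1r (@le_trans _ _ (`|K| / 2 ^+ k)) //.
    by rewrite ler_wpM2r ?invr_ge0 ?exprn_ge0 // ler_norm.
  rewrite ler_peMr // expR_ge1.
  by move: sT; rewrite in_itv /= subr_ge0 => /andP[].
apply: (@le0_geometric _ (`|c| + `|K| * expR (1 * (T - t)))) => k.
have := hL k.+1 t tT; have := h k.
have -> : Y t - L t = (X k.+1 t - L t) - (X k.+1 t - Y t).
  by rewrite opprB [RHS]addrC addrA subrK.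
have := ler_normB (X k.+1 t - L t) (X k.+1 t - Y t).
have : c / 2 ^+ k.+1 <= `|c| / 2 ^+ k.
  have p0 : 0 < (2 : R) ^+ k by rewrite exprn_gt0.
  apply: (@le_trans _ _ (`|c| / 2 ^+ k.+1)).
    by rewrite ler_wpM2r ?invr_ge0 ?exprn_ge0 // ler_norm.
  rewrite ler_wpM2l // lef_pV2 ?posrE ?exprn_gt0 // exprS; lra.
rewrite mulrDl -[_ / _ * expR _]mulrAC; lra.
Qed.

End MatrixFunctions.

(** * The Lyapunov equation *)

Section LyapunovEquation.
Context {R : realType} (d : nat) (T : R).
Hypothesis T_gt0 : 0 < T.
Notation mu := (@lebesgue_measure R).
Implicit Types (E H X Y N : 'M[R]_d).

(** The Lyapunov operator of a linear stochastic equation with drift matrix [E] and diffusion matrix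
    [H]. *)
Definition lyap E H X : 'M[R]_d := E^T *m X + X *m E + H^T *m X *m H.

Lemma lyapD E H X Y : lyap E H (X + Y) = lyap E H X + lyap E H Y.
Proof.
rewrite /lyap !mulmxDr !mulmxDl (addrACA (E^T *m X)).
by rewrite (addrACA (E^T *m X + _)).
Qed.

Lemma lyapN E H X : lyap E H (- X) = - lyap E H X.
Proof. by rewrite /lyap !mulmxN !mulNmx !opprD. Qed.

Lemma lyapB E H X Y : lyap E H (X - Y) = lyap E H X - lyap E H Y.
Proof. by rewrite lyapD lyapN. Qed.

Lemma lyap_tr E H X : (lyap E H X)^T = lyap E H X^T.
Proof.
by rewrite /lyap !linearD /= !trmx_mul !trmxK mulmxA [X in X + _]addrC.
Qed.

Lemma qform_lyap E H X x : X^T = X ->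
  qform (lyap E H X) x = 2 * bform X (E *m x) x + qform X (H *m x).
Proof.
move=> sX; rewrite /lyap !qformD qform_conj.
rewrite (_ : qform (E^T *m X) x = bform X (E *m x) x); last first.
  by rewrite /qform /bform trmx_mul !mulmxA.
rewrite (_ : qform (X *m E) x = bform X x (E *m x)); last first.
  by rewrite /qform /bform !mulmxA.
by rewrite (bformC x) //; ring.
Qed.

Lemma lyap_norm E H X (c : R) : `|E| <= c -> `|H| <= c ->
  `|lyap E H X| <= (2 * d%:R * c + d%:R ^+ 2 * c ^+ 2) * `|X|.
Proof.
move=> Ec Hc; have c0 : 0 <= c by apply: le_trans Ec.
have d0 : (0 : R) <= d%:R by [].
have h1 : `|E^T *m X| <= d%:R * (c * `|X|).
  by rewrite (le_trans (mxnorm_mul _ _)) // ler_wpM2l // ler_wpM2r // mxnorm_tr.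
have h2 : `|X *m E| <= d%:R * (c * `|X|).
  by rewrite (le_trans (mxnorm_mul _ _)) // ler_wpM2l // mulrC ler_wpM2r.
have h3 : `|H^T *m X| <= d%:R * (c * `|X|).
  by rewrite (le_trans (mxnorm_mul _ _)) // ler_wpM2l // ler_wpM2r // mxnorm_tr.
have h4 : `|H^T *m X *m H| <= d%:R * (d%:R * (c * `|X|) * c).
  by rewrite (le_trans (mxnorm_mul _ _)) // ler_wpM2l // ler_pM.
rewrite (le_trans (ler_normD _ _)) // (le_trans (lerD (ler_normD _ _) (lexx _))) //.
apply: le_trans (lerD (lerD h1 h2) h4) _.
by rewrite le_eqVlt; apply/orP; left; apply/eqP; ring.
Qed.

Lemma Linfty_lyap (E H X : R -> 'M[R]_d) : Linfty T E -> Linfty T H -> Linfty T X ->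
  Linfty T (fun t => lyap (E t) (H t) (X t)).
Proof.
move=> LE LH LX; apply: LinftyD; first apply: LinftyD.
- exact: LinftyM (Linfty_tr LE) LX.
- exact: LinftyM.
- exact: LinftyM (LinftyM (Linfty_tr LH) LX) LH.
Qed.

Lemma lyap_ae_norm (E H : R -> 'M[R]_d) : Linfty T E -> Linfty T H ->
  exists2 a : R, 0 < a & \forall t \ae mu, t \in `[0, T] ->
    forall X, `|lyap (E t) (H t) X| <= a * `|X|.
Proof.
move=> /(Linfty_bound)[e e0 hE] /(Linfty_bound)[h h0 hH].
pose c := Num.max e h; have c0 : 0 <= c by rewrite le_max e0.
pose a := 2 * d%:R * c + d%:R ^+ 2 * c ^+ 2 + 1.
have a0 : 0 < a by rewrite ltr_wpDl // addr_ge0 ?mulr_ge0 ?exprn_ge0.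
exists a => //; apply: filterS2 hE hH => t hE hH tT X.
apply: le_trans (lyap_norm X (_ : _ <= c) (_ : _ <= c)) _.
- by rewrite le_max hE.
- by rewrite le_max hH // orbT.
- by rewrite ler_wpM2r // /a lerDl.
Qed.

(** Picard iteration: the right-hand side is affine in the unknown with an essentially bounded
    coefficient, so increments satisfy the hypothesis of [iteration_limit]. *)
Lemma lyap_solvable (E H N : R -> 'M[R]_d) (G : 'M[R]_d) :
  Linfty T E -> Linfty T H -> Linfty T N ->
  exists2 X, mprimitive T X (fun t => - (lyap (E t) (H t) (X t) + N t)) & X T = G.
Proof.
move=> LE LH LN.
pose rhs (X : R -> 'M[R]_d) t := - (lyap (E t) (H t) (X t) + N t).
have Lrhs (X : R -> 'M[R]_d) : mcontinuous T X -> Linfty T (rhs X).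
  move=> cX; apply/LinftyN/LinftyD => //.
  exact: Linfty_lyap LE LH (Linfty_mcontinuous T_gt0 cX).
(* Choice needs a total step; its value at a discontinuous function is arbitrary and never met. *)
have ex (X : R -> 'M[R]_d) : exists Y : R -> 'M[R]_d,
    mcontinuous T X -> mprimitive T Y (rhs X) /\ Y T = G.
  have [cX|cX] := pselect (mcontinuous T X); last by exists X => /cX.
  by have [Y pY YT] := mprimitive_exists T_gt0 G (Lrhs X cX); exists Y.
have [step stepP] := choice ex.
pose X k := iter k step (fun=> G).
have cX k : mcontinuous T (X k).
  elim: k => [|k IH]; first exact: mcontinuous_cst.
  exact: mprimitive_mcontinuous (proj1 (stepP _ IH)).
pose f k := if k is k'.+1 then rhs (X k') else fun=> 0.
have pX k : mprimitive T (X k) (f k).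
  case: k => [|k]; last exact: (proj1 (stepP _ (cX k))).
  move=> i j; rewrite /X /f /=.
  rewrite [X in primitive_on _ _ _ X](_ : _ = fun=> 0); first exact: primitive_on_cst.
  by apply/funext => t; rewrite mxE.
have XT k : X k T = G by case: k => // k; exact: (proj2 (stepP _ (cX k))).
have [a a0 ha] := lyap_ae_norm LE LH.
have rhsB (Y Z : R -> 'M[R]_d) t : rhs Y t - rhs Z t = - lyap (E t) (H t) (Y t - Z t).
  by rewrite /rhs lyapB !opprD opprK addrACA subrr addr0 opprK.
have hf k : \forall t \ae mu, t \in `[0, T] ->
    `|f k.+2 t - f k.+1 t| <= a * (`|X k.+2 t - X k.+1 t| + `|X k.+1 t - X k t|).
  apply: filterS ha => t ha tT; rewrite /f rhsB normrN.
  by apply: le_trans (ha tT _) _; rewrite ler_pM2l // lerDr.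
have [c [L [cL hL]]] := iteration_limit T_gt0 a0 pX XT hf.
have hg k : \forall t \ae mu, t \in `[0, T] -> `|f k.+1 t - rhs L t| <= a * c / 2 ^+ k.
  apply: filterS ha => t ha tT; rewrite /f rhsB normrN.
  by apply: le_trans (ha tT _) _; rewrite -mulrA ler_pM2l // hL.
have [Y [pY YT YL]] := limit_primitive T_gt0 pX XT hL (Lrhs L cL) hg.
exists Y => //; apply: eq_mprimitive pY.
by apply: aeW => t tT; rewrite /rhs YL.
Qed.

(** * Positivity for Lyapunov inequalities *)

Lemma mprimitive_qform (F f : R -> 'M[R]_d) x : mprimitive T F f ->
  primitive_on 0 T (fun t => qform (F t) x) (fun t => qform (f t) x).
Proof.
move=> pF.
have Eq (G : R -> 'M[R]_d) : (fun t => qform (G t) x) =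
    fun t => \sum_i \sum_j x i 0 * x j 0 * G t i j.
  apply/funext => t; rewrite /qform bform_sum.
  by apply: eq_bigr => i _; apply: eq_bigr => j _; rewrite mulrAC.
rewrite !Eq; apply: primitive_on_sum => i; apply: primitive_on_sum => j.
exact: primitive_onZ.
Qed.

Lemma mprimitive_scalar (F f : R -> R) : primitive_on 0 T F f ->
  mprimitive T (fun t => (F t)%:M : 'M[R]_d) (fun t => (f t)%:M).
Proof.
move=> pF i j.
have Eq (G : R -> R) : (fun t => (G t)%:M i j) = fun t => (i == j)%:R * G t.
  by apply/funext => t; rewrite mxE mulr_natl.
by rewrite !Eq; exact: primitive_onZ.
Qed.

Lemma pd_perturb X : pdmx X -> exists2 e : R, 0 < e &
  forall Y, Y^T = Y -> `|Y - X| <= e -> pdmx Y.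
Proof.
move=> pX; have [a a0 ca] := pd_coercive pX.
have k0 : 0 < 2 * (2 * d%:R + 1) :> R by rewrite mulr_gt0 // ltr_wpDl // mulr_ge0.
exists (a / (2 * (2 * d%:R + 1))) => [|Y sY hY]; first by rewrite divr_gt0.
apply: (@coercive_pd _ _ (a / 2)) => //; first by rewrite divr_gt0.
move=> x; apply: le_trans (coercive_perturb Y ca x).
rewrite ler_wpM2r ?sqnorm_ge0 //.
have d0 : (0 : R) <= d%:R by [].
have : 2 * d%:R * `|Y - X| <= 2 * d%:R * (a / (2 * (2 * d%:R + 1))).
  by rewrite ler_wpM2l // mulr_ge0.
have -> : 2 * d%:R * (a / (2 * (2 * d%:R + 1))) = a / 2 - a / (2 * (2 * d%:R + 1)).
  by field; move: k0; rewrite !gt_eqF //; lra.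
have : 0 < a / (2 * (2 * d%:R + 1)) by rewrite divr_gt0.
lra.
Qed.

Lemma scalar_mxnorm (k : R) : `|(k%:M : 'M[R]_d)| <= `|k|.
Proof.
apply: mxnorm_le => // i j; rewrite mxE.
by case: (i == j); rewrite ?mulr1n ?mulr0n ?normr0.
Qed.

Lemma mulmx_sqnorm E x : sqnorm (E *m x) <= 2 * d%:R ^+ 2 * `|E| ^+ 2 * sqnorm x.
Proof.
have -> : sqnorm (E *m x) = qform (E^T *m E) x.
  by rewrite /sqnorm /qform /bform trmx_mul !mulmxA.
apply: le_trans (ler_norm _) _; apply: le_trans (qform_le _ _) _.
rewrite ler_wpM2r ?sqnorm_ge0 //.
have := mxnorm_mul E^T E; rewrite mxnorm_tr => h.
have -> : 2 * d%:R ^+ 2 * `|E| ^+ 2 = 2 * d%:R * (d%:R * (`|E| * `|E|)) :> R by ring.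
by rewrite ler_wpM2l // mulr_ge0.
Qed.

(* If positivity of the perturbed matrix first fails (backwards in time) at [s],
   in the direction [x], then it maps [x] to [0] at [s], so the differential
   inequality makes its quadratic form at [x] nonincreasing just after [s],
   although this form is positive after [s] and zero at [s]. *)
Lemma lyap_comparison_strict (E H D f : R -> 'M[R]_d) :
  Linfty T E -> Linfty T H -> mprimitive T D f ->
  (forall t, t \in `[0, T] -> (D t)^T = D t) -> psdmx (D T) ->
  (\forall t \ae mu, t \in `[0, T] -> forall x,
     qform (lyap (E t) (H t) (D t)) x <= - qform (f t) x) ->
  exists lam : R, forall e, 0 < e -> forall t, t \in `[0, T] ->
    pdmx (D t + (e * expR (lam * (T - t)))%:M).
Proof.
move=> LE LH pD sD DT hf.
have [a a0 ha] := lyap_ae_norm LE LH; have [c c0 hE] := Linfty_bound LE.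
(* [lam - 1] bounds the quadratic form of the Lyapunov operator at the identity; the surplus [1]
   leaves a margin [e * phi t * sqnorm x] in the final estimate. *)
pose lam := 2 * d%:R * (a * 1) + 1.
have lam0 : 0 < lam by rewrite ltr_wpDl // !mulr_ge0 // ltW.
exists lam => e e0.
pose phi t := expR (lam * (T - t)); pose De t := D t + (e * phi t)%:M.
have pDe : mprimitive T De (fun t => f t + (e * (- lam * phi t))%:M).
  apply: mprimitiveD => //; apply: mprimitive_scalar; apply: primitive_onZ.
  exact/primitive_on_expR/ltW.
have cDe := mprimitive_mcontinuous pDe.
have sDe t : t \in `[0, T] -> (De t)^T = De t.
  by move=> tT; rewrite linearD /= tr_scalar_mx sD.
have qDe t x : qform (De t) x = qform (D t) x + e * phi t * sqnorm x.
  by rewrite qformD -scalemx1 qformZ qform1.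
have phi_ge1 t : t \in `[0, T] -> 1 <= phi t.
  by rewrite in_itv /= => /andP[_ tT]; rewrite expR_ge1 mulr_ge0 ?subr_ge0 // ltW.
pose B := [set t | t \in `[0, T] /\ ~ pdmx (De t)].
move=> t0 t0T; apply: contrapT => nt0.
have Bt0 : B t0 by [].
have supB : has_sup B.
  split; first by exists t0.
  by exists T => t [+ _]; rewrite in_itv /= => /andP[].
pose s := sup B.
have sT : s \in `[0, T].
  rewrite in_itv /=; apply/andP; split.
    apply: le_trans (_ : t0 <= _); first by move: t0T; rewrite in_itv => /andP[].
    exact: sup_upper_bound.
  by apply: ge_sup; [exists t0 | move=> t [+ _]; rewrite in_itv /= => /andP[]].
have /andP[s0 sleT] : 0 <= s <= T by move: sT; rewrite in_itv.
(* The supremum is itself a bad time, because positive definiteness is an open condition and [De] is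
   continuous. *)
have nBs : ~ pdmx (De s).
  move=> /pd_perturb[k k0 hk].
  have /mcontinuousP/(_ s sT k k0)[r r0 rP] := cDe.
  have [t [tT nt] st] := sup_adherent r0 supB.
  have ts : t <= s by apply: sup_upper_bound.
  apply: nt; apply: hk; first exact: sDe.
  rewrite distrC; apply: rP => //.
  by rewrite ger0_norm ?subr_ge0 //; move: st; rewrite -/s; lra.
have s_ltT : s < T.
  rewrite lt_neqAle sleT andbT; apply/eqP => sE; apply: nBs; split.
    exact/symmetricmxP/sDe.
  move=> x x0; rewrite -/(bform _ _ _) -/(qform _ _) qDe ltr_wpDl //.
    by rewrite sE qform_psd_ge0.
  by rewrite !mulr_gt0 ?sqnorm_gt0 // expR_gt0.
have pdDe t : s < t -> t <= T -> pdmx (De t).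
  move=> st tT; apply: contrapT => nt.
  have : t <= s.
    apply: sup_upper_bound => //; split=> //.
    by rewrite in_itv /= tT (le_trans s0) // ltW.
  by rewrite leNgt st.
(* At [s] the form is a limit from the right of positive ones: a negative value at [x] would persist
   at the nearby time [t2]. *)
have psdDe t : s <= t -> t <= T -> psdmx (De t).
  rewrite le_eqVlt => /predU1P[<- _|st tT]; last exact/pd_psd/pdDe.
  split; first exact/symmetricmxP/sDe.
  move=> x; rewrite -/(bform _ _ _) -/(qform _ _) leNgt; apply/negP => q0.
  have [x0|x0] := eqVneq x 0.
    by move: q0; rewrite x0 /qform /bform mulmx0 mxE ltxx.
  have sq0 : 0 < sqnorm x by rewrite sqnorm_gt0.
  pose k := - qform (De s) x / (2 * d%:R + 1) / sqnorm x.
  have dd0 : 0 < 2 * d%:R + 1 :> R by rewrite ltr_wpDl // mulr_ge0.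
  have k0 : 0 < k by rewrite !divr_gt0 // oppr_gt0.
  have /mcontinuousP/(_ s sT k k0)[r r0 rP] := cDe.
  pose t2 := Num.min T (s + r / 2).
  have st : s < t2 by rewrite lt_min s_ltT /= ltrDl divr_gt0.
  have tT : t2 <= T by rewrite ge_min lexx.
  have tr : t2 <= s + r / 2 by rewrite ge_min lexx orbT.
  have := proj2 (pdDe t2 st tT) x x0.
  apply/negP; rewrite -leNgt -/(bform _ _ _) -/(qform _ _).
  have h1 : `|De s - De t2| <= k.
    apply: rP; first by rewrite in_itv /= tT (le_trans s0) // ltW.
    by rewrite distrC ger0_norm ?subr_ge0 ?(ltW st) //; move: tr r0; lra.
  have := qform_le (De t2 - De s) x; rewrite distrC in h1.
  rewrite qformB ler_norml => /andP[_ h2].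
  have h3 : 2 * d%:R * `|De t2 - De s| * sqnorm x <= 2 * d%:R * k * sqnorm x.
    by rewrite ler_wpM2r ?(ltW sq0) // ler_wpM2l // mulr_ge0.
  have h4 : 2 * d%:R * k * sqnorm x <= (2 * d%:R + 1) * k * sqnorm x.
    by rewrite ler_wpM2r ?(ltW sq0) // ler_wpM2r ?(ltW k0) // lerDl.
  have h5 : (2 * d%:R + 1) * k * sqnorm x = - qform (De s) x.
    by rewrite /k; field; rewrite !gt_eqF.
  by move: h2 h3 h4 h5; lra.
have [x x0 qx0] : exists2 x, x != 0 & qform (De s) x = 0.
  apply: contrapT => nx; apply: nBs; split; first exact/symmetricmxP/sDe.
  move=> x x0; rewrite -/(bform _ _ _) -/(qform _ _) lt_def.
  rewrite (qform_psd_ge0 x (psdDe s (lexx s) sleT)) andbT; apply/eqP => qx; apply: nx.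
  by exists x.
have Dx : De s *m x = 0 by apply: psd_qform0 => //; exact: psdDe.
have sq0 : 0 < sqnorm x by rewrite sqnorm_gt0.
(* [kap * sqnorm x] dominates [sqnorm (E t x) + sqnorm x]; the closeness [e / (2 d + 1) / kap] then
   keeps the cross term [h6] above [- e * sqnorm x]. *)
pose kap := 2 * d%:R ^+ 2 * c ^+ 2 + 1.
have kap0 : 0 < kap by rewrite ltr_wpDl // mulr_ge0 ?sqr_ge0 // mulr_ge0 ?sqr_ge0.
have dd0 : 0 < 2 * d%:R + 1 :> R by rewrite ltr_wpDl // mulr_ge0.
have k0 : 0 < e / (2 * d%:R + 1) / kap by rewrite !divr_gt0.
have /mcontinuousP/(_ s sT _ k0)[r r0 rP] := cDe.
pose t1 := Num.min T (s + r / 2).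
have st1 : s < t1 by rewrite lt_min s_ltT /= ltrDl divr_gt0.
have t1T : t1 <= T by rewrite ge_min lexx.
have t1r : t1 <= s + r / 2 by rewrite ge_min lexx orbT.
have pq := primitive_onZ (-1) (primitive_onS s0 t1T (mprimitive_qform x pDe)).
have := primitive_on_le (ltW st1) pq; rewrite qx0 mulr0 => /(_ _) hle.
have : 0 <= -1 * qform (De t1) x.
  apply: hle; apply: filterS3 hf hE ha => t hft hEt hat; rewrite in_itv /= => /andP[st tt1].
  have tT : t \in `[0, T] by rewrite in_itv /= (le_trans s0) // (le_trans tt1).
  have tleT := le_trans tt1 t1T.
  have hD : `|De t - De s| <= e / (2 * d%:R + 1) / kap.
    rewrite distrC; apply: rP => //.
    by rewrite distrC ger0_norm ?subr_ge0 //; move: tt1 t1r r0; lra.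
  have h1 : - qform (f t) x >= qform (lyap (E t) (H t) (D t)) x by exact: hft.
  have DE : D t = De t - (e * phi t) *: 1%:M by rewrite /De -scalemx1 addrK.
  have lyapZ1 k : lyap (E t) (H t) (k *: 1%:M) = k *: lyap (E t) (H t) 1%:M.
    by rewrite /lyap -!scalemxAr -!scalemxAl !scalerDr.
  have h2 : qform (lyap (E t) (H t) (D t)) x = qform (lyap (E t) (H t) (De t)) x
      - e * phi t * qform (lyap (E t) (H t) 1%:M) x.
    by rewrite DE lyapB lyapZ1 qformB qformZ.
  have h3 : qform (lyap (E t) (H t) 1%:M) x <= (lam - 1) * sqnorm x.
    apply: le_trans (ler_norm _) _; apply: le_trans (qform_le _ _) _.
    rewrite ler_wpM2r ?(ltW sq0) // /lam addrK ler_wpM2l ?mulr_ge0 //.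
    apply: le_trans (hat tT _) _; rewrite ler_pM2l //.
    by apply: le_trans (scalar_mxnorm 1) _; rewrite normr1.
  have h4 := qform_lyap (E t) (H t) x (sDe t tT).
  have h5 : 0 <= qform (De t) (H t *m x) by apply/qform_psd_ge0/psdDe.
  (* Since [De s] kills [x], only the small difference [De t - De s] contributes to the cross
     term. *)
  have h6 : - (e * sqnorm x) <= 2 * bform (De t) (E t *m x) x.
    have -> : bform (De t) (E t *m x) x = bform (De t - De s) (E t *m x) x.
      by rewrite /bform mulmxBr mulmxBl -[_ *m De s *m x]mulmxA Dx mulmx0 subr0.
    have := bform_le (De t - De s) (E t *m x) x; rewrite ler_norml => /andP[+ _].
    have hx : sqnorm (E t *m x) + sqnorm x <= kap * sqnorm x.
      rewrite /kap [leRHS]mulrDl mul1r lerD2r.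
      apply: le_trans (mulmx_sqnorm _ _) _.
      rewrite ler_wpM2r ?(ltW sq0) // ler_wpM2l ?mulr_ge0 ?sqr_ge0 //.
      by rewrite ler_sqr ?nnegrE //; exact: hEt.
    have hh : d%:R * `|De t - De s| * (sqnorm (E t *m x) + sqnorm x) <=
        d%:R * (e / (2 * d%:R + 1) / kap) * (kap * sqnorm x).
      rewrite ler_pM // ?mulr_ge0 ?addr_ge0 ?sqnorm_ge0 //.
      by rewrite ler_wpM2l.
    have Ehh : d%:R * (e / (2 * d%:R + 1) / kap) * (kap * sqnorm x) =
        (e * sqnorm x) / 2 - (e * sqnorm x) / (2 * (2 * d%:R + 1)).
      by field; rewrite !gt_eqF.
    have : 0 < e * sqnorm x / (2 * (2 * d%:R + 1)).
      by rewrite divr_gt0 ?mulr_gt0.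
    by move: hh; rewrite Ehh; lra.
  rewrite qformD -scalemx1 qformZ qform1.
  have h7 : e * sqnorm x <= e * phi t * sqnorm x.
    by rewrite ler_wpM2r ?(ltW sq0) // ler_peMr ?(ltW e0) ?phi_ge1.
  have ep0 : 0 < e * phi t by rewrite mulr_gt0 // expR_gt0.
  have h8 : e * phi t * qform (lyap (E t) (H t) 1%:M) x <=
      e * phi t * ((lam - 1) * sqnorm x) by rewrite ler_pM2l.
  move: h1 h2 h4 h5 h6 h7 h8; lra.
have := proj2 (pdDe t1 st1 t1T) x x0.
rewrite -/(bform _ _ _) -/(qform _ _); lra.
Qed.

(** Let [e] tend to zero in the strict version, whose exponent [lam] does not depend on [e]. *)
Lemma lyap_comparison (E H D f : R -> 'M[R]_d) :
  Linfty T E -> Linfty T H -> mprimitive T D f ->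
  (forall t, t \in `[0, T] -> (D t)^T = D t) -> psdmx (D T) ->
  (\forall t \ae mu, t \in `[0, T] -> forall x,
     qform (lyap (E t) (H t) (D t)) x <= - qform (f t) x) ->
  forall t, t \in `[0, T] -> psdmx (D t).
Proof.
move=> LE LH pD sD DT hf t tT.
have [lam hlam] := lyap_comparison_strict LE LH pD sD DT hf.
split; first exact/symmetricmxP/sD.
move=> x; rewrite -/(bform _ _ _) -/(qform _ _).
set p := expR (lam * (T - t)); have p0 : 0 < p by exact: expR_gt0.
have k0 : 0 < p * sqnorm x + 1 by rewrite ltr_wpDl // mulr_ge0 ?sqnorm_ge0 // ltW.
apply/ler_addgt0Pr => k kgt0; rewrite addrC.
have := hlam _ (divr_gt0 kgt0 k0) t tT => /pd_psd/(qform_psd_ge0 x).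
rewrite qformD -scalemx1 qformZ qform1 -/p => h; apply: le_trans h _.
rewrite [leRHS]addrC lerD2l -mulrA mulrAC ler_pdivrMr // ler_pM2l //.
by rewrite lerDl.
Qed.

End LyapunovEquation.

(** * Completing the square *)

Section RiccatiAlgebra.
Context {R : realType} {d : nat}.
Implicit Types (A B C D Rc Q X Y Z Th M N : 'M[R]_d).

Definition ric_K B C D X : 'M[R]_d := X *m B + C^T *m X *m D.
Definition ric_S D Rc X : 'M[R]_d := Rc + D^T *m X *m D.
Definition ric_feedback B C D Rc X : 'M[R]_d :=
  invmx (ric_S D Rc X) *m (ric_K B C D X)^T.
Definition ric_cost A B C D Rc Q Th X : 'M[R]_d :=
  lyap (A - B *m Th) (C - D *m Th) X + Q + Th^T *m Rc *m Th.

Let trmxB M N : (M - N)^T = M^T - N^T.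
Proof. exact: linearB. Qed.

Let trmxD M N : (M + N)^T = M^T + N^T.
Proof. exact: linearD. Qed.

Lemma ric_cost_expand A B C D Rc Q Th X : X^T = X ->
  ric_cost A B C D Rc Q Th X = lyap A C X + Q - ric_K B C D X *m Th
    - Th^T *m (ric_K B C D X)^T + Th^T *m ric_S D Rc X *m Th.
Proof.
move=> sX; rewrite /ric_cost /lyap /ric_K /ric_S.
rewrite !trmxB !trmx_mul trmxD !trmx_mul !trmxK sX.
rewrite !(mulmxDr, mulmxDl) !mulNmx !mulmxN !mulmxA.
(* Every product becomes an atom, so that the identity is purely additive and holds entry by
   entry. *)
move: (A^T *m X) (X *m A) (C^T *m X *m C) (Th^T *m B^T *m X) (X *m B *m Th)
  (Th^T *m D^T *m X *m C) (C^T *m X *m D *m Th) (Th^T *m D^T *m X *m D *m Th)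
  (Th^T *m Rc *m Th) => ? ? ? ? ? ? ? ? ?.
by apply/matrixP => ? ?; rewrite !mxE; ring.
Qed.

Lemma ric_S_sym D Rc X : X^T = X -> Rc^T = Rc -> (ric_S D Rc X)^T = ric_S D Rc X.
Proof.
by move=> sX sR; rewrite /ric_S trmxD !trmx_mul trmxK sX sR mulmxA.
Qed.

Section Optimal.
Variables (A B C D Rc Q X : 'M[R]_d).
Hypotheses (sX : X^T = X) (sR : Rc^T = Rc) (uS : ric_S D Rc X \in unitmx).

Lemma ric_cost_feedback :
  ric_cost A B C D Rc Q (ric_feedback B C D Rc X) X =
  lyap A C X + Q - ric_K B C D X *m invmx (ric_S D Rc X) *m (ric_K B C D X)^T.
Proof.
have sS := ric_S_sym D sX sR.
rewrite ric_cost_expand // /ric_feedback; move: uS sS.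
move: (ric_S _ _ _) (ric_K _ _ _ _) => S K uS' sS.
rewrite trmx_mul trmxK trmx_inv sS mulmxKV // !mulmxA.
by rewrite subrK.
Qed.

Lemma ric_cost_square Th :
  ric_cost A B C D Rc Q Th X =
  ric_cost A B C D Rc Q (ric_feedback B C D Rc X) X +
  (Th - ric_feedback B C D Rc X)^T *m ric_S D Rc X *m (Th - ric_feedback B C D Rc X).
Proof.
have sS := ric_S_sym D sX sR.
rewrite ric_cost_feedback ric_cost_expand // -!(mulmxA _ (invmx _)).
rewrite -/(ric_feedback B C D Rc X); set P := ric_feedback B C D Rc X.
(* The stationarity condition of the minimization, which makes the cross terms combine into a
   square. *)
have SP : ric_S D Rc X *m P = (ric_K B C D X)^T by rewrite mulKVmx.
have PS : P^T *m ric_S D Rc X = ric_K B C D X.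
  by rewrite -[LHS]trmxK trmx_mul trmxK sS SP trmxK.
rewrite trmxB mulmxBl mulmxBr PS !mulmxBl -(mulmxA Th^T _ P) SP.
move: (lyap A C X) (ric_K _ _ _ _ *m P) (_ *m _ *m Th) (_ *m _^T) (_ *m Th) => ? ? ? ? ?.
by apply/matrixP => ? ?; rewrite !mxE; ring.
Qed.

End Optimal.

Lemma ric_cost_min A B C D Rc Q X Th x : X^T = X -> Rc^T = Rc ->
  pdmx (ric_S D Rc X) ->
  qform (ric_cost A B C D Rc Q (ric_feedback B C D Rc X) X) x <=
  qform (ric_cost A B C D Rc Q Th X) x.
Proof.
move=> sX sR pS; have [a a0 ca] := pd_coercive pS.
have uS := coercive_unit a0 (ric_S_sym D sX sR) ca.
rewrite (ric_cost_square A B C Q sX sR uS Th) qformD lerDl qform_conj.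
exact/qform_psd_ge0/pd_psd.
Qed.

Lemma ric_costD A B C D Rc Q Rc' Q' Th X X' :
  ric_cost A B C D (Rc + Rc') (Q + Q') Th (X + X') =
  ric_cost A B C D Rc Q Th X + ric_cost A B C D Rc' Q' Th X'.
Proof.
rewrite /ric_cost lyapD mulmxDr mulmxDl.
move: (lyap _ _ X) (lyap _ _ X') (_ *m Rc *m _) (_ *m Rc' *m _) => ? ? ? ?.
by apply/matrixP => ? ?; rewrite !mxE; ring.
Qed.

Lemma lyapZ A C (k : R) X : lyap A C (k *: X) = k *: lyap A C X.
Proof. by rewrite /lyap -!scalemxAr -!scalemxAl !scalerDr. Qed.

Lemma ric_costZ A B C D (k : R) Rc Q Th X :
  ric_cost A B C D (k *: Rc) (k *: Q) Th (k *: X) = k *: ric_cost A B C D Rc Q Th X.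
Proof. by rewrite /ric_cost lyapZ -scalemxAr -scalemxAl !scalerDr. Qed.

Lemma ric_SD D Rc Rc' X X' :
  ric_S D (Rc + Rc') (X + X') = ric_S D Rc X + ric_S D Rc' X'.
Proof. by rewrite /ric_S mulmxDr mulmxDl addrACA. Qed.

Lemma ric_SZ D k Rc X : ric_S D (k *: Rc) (k *: X) = k *: ric_S D Rc X.
Proof. by rewrite /ric_S -scalemxAr -scalemxAl scalerDr. Qed.

Lemma mxnorm_mul_le M N (a b : R) : `|M| <= a -> `|N| <= b ->
  `|M *m N| <= d%:R * (a * b).
Proof.
move=> Ma Nb; apply: le_trans (mxnorm_mul _ _) _.
by rewrite ler_wpM2l // ler_pM.
Qed.

Lemma mxnormD_le M N (a b : R) : `|M| <= a -> `|N| <= b -> `|M + N| <= a + b.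
Proof. by move=> Ma Nb; apply: le_trans (ler_normD _ _) (lerD Ma Nb). Qed.

Lemma mxnormB_le M N (a b : R) : `|M| <= a -> `|N| <= b -> `|M - N| <= a + b.
Proof. by move=> Ma Nb; apply: le_trans (ler_normB _ _) (lerD Ma Nb). Qed.

Lemma invmxB M N : M \in unitmx -> N \in unitmx ->
  invmx M - invmx N = invmx M *m (N - M) *m invmx N.
Proof. by move=> uM uN; rewrite mulmxBr mulmxBl mulmxK // mulVmx // mul1mx. Qed.

(** The estimate behind the convergence of policy iteration. The constant depends only on [d], [c]
    and [dl], hence is uniform in time and along the iteration. *)
Lemma ric_cost_lipschitz (c dl : R) : 0 < c -> 0 < dl ->
  exists2 a, 0 < a & forall A B C D Rc Q X Y Z,
    [/\ `|A| <= c, `|B| <= c, `|C| <= c, `|D| <= c & `|Rc| <= c] ->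
    `|Y| <= c -> `|Z| <= c -> Y^T = Y -> Z^T = Z -> Rc^T = Rc ->
    coercive dl (ric_S D Rc Y) -> coercive dl (ric_S D Rc Z) ->
    `|ric_cost A B C D Rc Q (ric_feedback B C D Rc Y) X -
      ric_cost A B C D Rc Q (ric_feedback B C D Rc Z) Z| <=
    a * (`|X - Z| + `|Y - Z|).
Proof.
move=> c0 dl0; pose n : R := d%:R; have n0 : 0 <= n by [].
(* [i] bounds the inverse weights, [k1] and [s1] are the norms of [ric_K] and of [M |-> D^T M D],
   [th] and [l] are the bound and the Lipschitz constant of the feedback, [e] bounds the closed-loop
   matrices and [sz] the weight at [Z]. *)
pose i := dl^-1; have i0 : 0 < i by rewrite invr_gt0.
pose k1 := n * c + n * (n * c * c).
have k10 : 0 <= k1 by rewrite addr_ge0 ?mulr_ge0 // ltW.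
pose s1 := n * (n * c * c); have s10 : 0 <= s1 by rewrite !mulr_ge0 // ltW.
pose th := n * (i * (k1 * c)).
have th0 : 0 <= th by rewrite !mulr_ge0 // ltW.
pose l := n * (n * (n * (i * s1) * i) * (k1 * c)) + n * (i * k1).
have l0 : 0 <= l by rewrite addr_ge0 ?mulr_ge0 // ltW.
pose e := c + n * (c * th); have e0 : 0 <= e by rewrite addr_ge0 ?mulr_ge0 // ltW.
pose sz := c + s1 * c; have sz0 : 0 <= sz by rewrite addr_ge0 ?mulr_ge0 // ltW.
pose a1 := 2 * n * e + n ^+ 2 * e ^+ 2.
pose a2 := n * (n * ((th + th) * sz) * l).
have a10 : 0 <= a1 by rewrite addr_ge0 ?mulr_ge0 ?exprn_ge0.
have a20 : 0 <= a2 by rewrite !mulr_ge0 // addr_ge0.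
exists (a1 + a2 + 1); first by rewrite ltr_wpDl // addr_ge0.
move=> A B C D Rc Q X Y Z [hA hB hC hD hR] hY hZ sY sZ sR cY cZ.
have uY := coercive_unit dl0 (ric_S_sym D sY sR) cY.
have uZ := coercive_unit dl0 (ric_S_sym D sZ sR) cZ.
have iY := coercive_inv_le dl0 (ric_S_sym D sY sR) cY.
have iZ := coercive_inv_le dl0 (ric_S_sym D sZ sR) cZ.
have hDD M : `|D^T *m M *m D| <= s1 * `|M|.
  rewrite /s1 -!mulrA; have hDt : `|D^T| <= c by rewrite mxnorm_tr.
  apply: le_trans (mxnorm_mul_le (mxnorm_mul_le hDt (lexx `|M|)) hD) _.
  by rewrite le_eqVlt; apply/orP; left; apply/eqP; rewrite /n; ring.
have hK M : `|(ric_K B C D M)^T| <= k1 * `|M|.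
  rewrite mxnorm_tr /ric_K; have hCt : `|C^T| <= c by rewrite mxnorm_tr.
  have := mxnormD_le (mxnorm_mul_le (lexx `|M|) hB)
    (mxnorm_mul_le (mxnorm_mul_le hCt (lexx `|M|)) hD).
  move=> /le_trans; apply.
  by rewrite le_eqVlt; apply/orP; left; apply/eqP; rewrite /k1 /n; ring.
have hKc M : `|M| <= c -> `|(ric_K B C D M)^T| <= k1 * c.
  by move=> Mc; apply: le_trans (hK M) _; rewrite ler_wpM2l.
have thY : `|ric_feedback B C D Rc Y| <= th by apply: mxnorm_mul_le => //; exact: hKc.
have thZ : `|ric_feedback B C D Rc Z| <= th by apply: mxnorm_mul_le => //; exact: hKc.
have hS : `|ric_S D Rc Z - ric_S D Rc Y| <= s1 * `|Y - Z|.
  rewrite distrC /ric_S opprD addrACA subrr add0r -mulmxBl -mulmxBr; exact: hDD.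
have thB : `|ric_feedback B C D Rc Y - ric_feedback B C D Rc Z| <= l * `|Y - Z|.
  have -> : ric_feedback B C D Rc Y - ric_feedback B C D Rc Z =
    (invmx (ric_S D Rc Y) - invmx (ric_S D Rc Z)) *m (ric_K B C D Y)^T +
    invmx (ric_S D Rc Z) *m (ric_K B C D (Y - Z))^T.
    have -> : ric_K B C D (Y - Z) = ric_K B C D Y - ric_K B C D Z.
      by rewrite /ric_K !mulmxBr !mulmxBl opprD addrACA.
    by rewrite /ric_feedback trmxB mulmxBl mulmxBr addrA subrK.
  rewrite invmxB //.
  have := mxnormD_le (mxnorm_mul_le (mxnorm_mul_le (mxnorm_mul_le iY hS) iZ) (hKc Y hY))
    (mxnorm_mul_le iZ (hK (Y - Z))).
  move=> /le_trans; apply.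
  by rewrite le_eqVlt; apply/orP; left; apply/eqP; rewrite /l /n /i; ring.
(* At fixed feedback the cost is affine in the state, which gives the Lyapunov term; changing the
   feedback at [Z] costs a square, since the feedback of [Z] is optimal there. *)
have -> : ric_cost A B C D Rc Q (ric_feedback B C D Rc Y) X -
      ric_cost A B C D Rc Q (ric_feedback B C D Rc Z) Z =
    lyap (A - B *m ric_feedback B C D Rc Y) (C - D *m ric_feedback B C D Rc Y) (X - Z) +
    (ric_feedback B C D Rc Y - ric_feedback B C D Rc Z)^T *m ric_S D Rc Z *m
    (ric_feedback B C D Rc Y - ric_feedback B C D Rc Z).
  set Y' := ric_feedback B C D Rc Y; set Z' := ric_feedback B C D Rc Z.
  have -> : (Y' - Z')^T *m ric_S D Rc Z *m (Y' - Z') =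
      ric_cost A B C D Rc Q Y' Z - ric_cost A B C D Rc Q Z' Z.
    by rewrite (ric_cost_square A B C Q sZ sR uZ Y') [RHS]addrC addKr.
  rewrite lyapB /ric_cost; set L := lyap _ _ Z; set L' := lyap _ _ X; set L2 := lyap _ _ Z.
  move: L L' L2 (_ *m Rc *m Y') (_ *m Rc *m Z') => ? ? ? ? ?.
  by apply/matrixP => ? ?; rewrite !mxE; ring.
have hE : `|A - B *m ric_feedback B C D Rc Y| <= e.
  exact: mxnormB_le hA (mxnorm_mul_le hB thY).
have hH : `|C - D *m ric_feedback B C D Rc Y| <= e.
  exact: mxnormB_le hC (mxnorm_mul_le hD thY).
have hSZ : `|ric_S D Rc Z| <= sz.
  apply: mxnormD_le => //; apply: le_trans (hDD Z) _.
  by rewrite ler_wpM2l.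
have thBt : `|(ric_feedback B C D Rc Y - ric_feedback B C D Rc Z)^T| <= th + th.
  by rewrite mxnorm_tr; exact: mxnormB_le.
have := mxnormD_le (lyap_norm (X - Z) hE hH)
  (mxnorm_mul_le (mxnorm_mul_le thBt hSZ) thB).
move=> /le_trans; apply.
have -> : d%:R * (d%:R * ((th + th) * sz) * (l * `|Y - Z|)) = a2 * `|Y - Z|.
  by rewrite /a2 /n; ring.
rewrite -/n -/a1 mulrDr; apply: lerD; rewrite ler_wpM2r //.
  by rewrite -addrA lerDl addr_ge0.
by rewrite addrAC lerDr addr_ge0.
Qed.

(** The difference is positive semidefinite with zero quadratic form, so it annihilates each basis
    vector. *)
Lemma loewner_antisym M N : loewner_le M N -> loewner_le N M -> M = N.
Proof.
move=> MN NM; have q0 x : qform (N - M) x = 0.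
  apply/eqP; rewrite eq_le (qform_psd_ge0 x MN) andbT.
  by have := qform_psd_ge0 x NM; rewrite -opprB qformN oppr_ge0.
apply/esym/eqP; rewrite -subr_eq0; apply/eqP/matrixP => i j.
have := psd_qform0 MN (q0 (delta_mx j 0)); rewrite -colE => /matrixP/(_ i 0).
by rewrite !mxE.
Qed.

Lemma loewner_refl M : M^T = M -> loewner_le M M.
Proof. by move=> sM; exact: qform_loewner. Qed.

End RiccatiAlgebra.

(** * Policy iteration *)

Section RiccatiEquation.
Context {R : realType} (d : nat) (T : R).
Hypothesis T_gt0 : 0 < T.
Notation mu := (@lebesgue_measure R).
Implicit Types (F X Y W Th Rc Q : R -> 'M[R]_d).

Definition symmetric_on X := forall t, t \in `[0, T] -> (X t)^T = X t.

(** Near each time half of the pointwise coercivity constant survives by continuity;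
    [interval_additive] patches finitely many of them together. *)
Lemma uniform_coercive F : mcontinuous T F ->
  (forall t, t \in `[0, T] -> pdmx (F t)) ->
  exists2 a : R, 0 < a & forall t, t \in `[0, T] -> coercive a (F t).
Proof.
move=> /mcontinuousP cF pF.
pose S u v := exists2 a : R, 0 < a & forall t, t \in `[u, v] -> coercive a (F t).
apply: (@interval_additive _ 0 T S (ltW T_gt0)) =>
  [x y z _ xy yz _ [a a0 ha] [b b0 hb]|t t0 tT].
  exists (Num.min a b) => [|t]; first by rewrite lt_min a0.
  rewrite in_itv /= => /andP[xt tz] v; case: (leP t y) => ty.
    apply: le_trans (ha t _ v); last by rewrite in_itv /= xt.
    by rewrite ler_wpM2r ?sqnorm_ge0 // ge_min lexx.
  apply: le_trans (hb t _ v); last by rewrite in_itv /= tz ltW.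
  by rewrite ler_wpM2r ?sqnorm_ge0 // ge_min lexx orbT.
have tin : t \in `[0, T] by rewrite in_itv /= t0.
have [a a0 ha] := pd_coercive (pF t tin).
have d0 : (0 : R) <= d%:R by [].
have k0 : 0 < 4 * (d%:R + 1) :> R by rewrite mulr_gt0 // ltr_wpDl.
have [r r0 rP] := cF t tin _ (divr_gt0 a0 k0).
exists r => // u v u0 ut tv vT uvr; exists (a / 2) => [|s]; first by rewrite divr_gt0.
rewrite in_itv /= => /andP[us sv] x.
have sin : s \in `[0, T] by rewrite in_itv /= (le_trans u0) // (le_trans sv).
have hs : `|F t - F s| <= a / (4 * (d%:R + 1)).
  by apply: rP => //; rewrite ltr_norml; apply/andP; split; move: uvr ut tv us sv; lra.
apply: le_trans (coercive_perturb (F s) ha x); rewrite ler_wpM2r ?sqnorm_ge0 //.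
have : 2 * d%:R * `|F s - F t| <= 2 * d%:R * (a / (4 * (d%:R + 1))).
  by rewrite distrC ler_wpM2l // mulr_ge0.
have -> : 2 * d%:R * (a / (4 * (d%:R + 1))) = a / 2 - a / (2 * (d%:R + 1)).
  by field; rewrite gt_eqF // ltr_wpDl.
have : 0 < a / (2 * (d%:R + 1)) by rewrite divr_gt0 // mulr_gt0 // ltr_wpDl.
lra.
Qed.

Lemma mcontinuous_inv F (a : R) : 0 < a -> mcontinuous T F -> symmetric_on F ->
  (forall t, t \in `[0, T] -> coercive a (F t)) ->
  mcontinuous T (fun t => invmx (F t)).
Proof.
move=> a0 /mcontinuousP cF sF ha; apply/mcontinuousP => t tT e e0.
have d0 : (0 : R) <= d%:R by [].
(* In the resolvent identity the two inverses and the two products cost [d^2 / a^2]; the [+ 1] keeps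
   [k] positive for every [d]. *)
pose k := (d%:R ^+ 2 + 1) / a ^+ 2.
have k0 : 0 < k by rewrite divr_gt0 ?exprn_gt0 // ltr_wpDl ?exprn_ge0.
have [r r0 rP] := cF t tT _ (divr_gt0 e0 k0).
exists r => // s sT ts.
have ut := coercive_unit a0 (sF t tT) (ha t tT).
have us := coercive_unit a0 (sF s sT) (ha s sT).
rewrite invmxB //.
have it := coercive_inv_le a0 (sF t tT) (ha t tT).
have is_ := coercive_inv_le a0 (sF s sT) (ha s sT).
have hd := rP s sT ts; rewrite distrC in hd.
apply: le_trans (mxnorm_mul_le (mxnorm_mul_le it hd) is_) _.
have -> : d%:R * (d%:R * (a^-1 * (e / k)) * a^-1) = (d%:R ^+ 2 / (d%:R ^+ 2 + 1)) * e.
  rewrite /k; field; rewrite !gt_eqF // ltr_wpDl ?exprn_ge0 //.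
rewrite ler_piMl ?(ltW e0) // ler_pdivrMr ?ltr_wpDl ?exprn_ge0 // mul1r lerDl //.
Qed.

Variables (A B C D : R -> 'M[R]_d).
Hypotheses (LA : Linfty T A) (LB : Linfty T B) (LC : Linfty T C).
Hypothesis cD : mcontinuous T D.

Let LD : Linfty T D := Linfty_mcontinuous T_gt0 cD.

Definition cost_at Rc Q Th X t :=
  ric_cost (A t) (B t) (C t) (D t) (Rc t) (Q t) (Th t) (X t).
Definition feedback_at Rc X t := ric_feedback (B t) (C t) (D t) (Rc t) (X t).
Definition weight_at Rc X t := ric_S (D t) (Rc t) (X t).

Lemma mcontinuous_weight Rc X : mcontinuous T Rc -> mcontinuous T X ->
  mcontinuous T (weight_at Rc X).
Proof.
move=> cR cX; apply: mcontinuousD => //; apply: mcontinuousM => //.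
by apply: mcontinuousM => //; exact: mcontinuous_tr.
Qed.

Lemma symmetric_weight Rc X : symmetric_on Rc -> symmetric_on X ->
  symmetric_on (weight_at Rc X).
Proof. by move=> sR sX t tT; apply: ric_S_sym; [exact: sX | exact: sR]. Qed.

Lemma Linfty_feedback Rc X (a : R) : 0 < a ->
  mcontinuous T Rc -> mcontinuous T X -> symmetric_on Rc -> symmetric_on X ->
  (forall t, t \in `[0, T] -> coercive a (weight_at Rc X t)) ->
  Linfty T (feedback_at Rc X).
Proof.
move=> a0 cR cX sR sX ha; have LX := Linfty_mcontinuous T_gt0 cX.
apply: LinftyM.
  apply: (Linfty_mcontinuous T_gt0); apply: (mcontinuous_inv a0) => //.
    exact: mcontinuous_weight.
  exact: symmetric_weight.
apply: Linfty_tr; apply: LinftyD; first exact: LinftyM.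
by apply: LinftyM => //; apply: LinftyM => //; exact: Linfty_tr.
Qed.

Lemma Linfty_drift Th : Linfty T Th -> Linfty T (fun t => A t - B t *m Th t).
Proof. by move=> LT; apply: LinftyB => //; exact: LinftyM. Qed.

Lemma Linfty_diffusion Th : Linfty T Th -> Linfty T (fun t => C t - D t *m Th t).
Proof. by move=> LT; apply: LinftyB => //; exact: LinftyM. Qed.

Lemma Linfty_cost Rc Q Th X : Linfty T Rc -> Linfty T Q -> Linfty T Th ->
  Linfty T X -> Linfty T (cost_at Rc Q Th X).
Proof.
move=> LR LQ LT LX; apply: LinftyD; first apply: LinftyD => //.
  by apply: Linfty_lyap => //; [exact: Linfty_drift | exact: Linfty_diffusion].
by apply: LinftyM => //; apply: LinftyM => //; exact: Linfty_tr.
Qed.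

(** With a common feedback the terms in [Q] and [Rc] cancel in the difference, which leaves a
    homogeneous Lyapunov inequality for [Y - X]. *)
Lemma cost_comparison Rc Q Th X f Y g : Linfty T Th ->
  mprimitive T X f -> mprimitive T Y g -> symmetric_on X -> symmetric_on Y ->
  loewner_le (X T) (Y T) ->
  (\forall t \ae mu, t \in `[0, T] -> forall x,
     - qform (f t) x <= qform (cost_at Rc Q Th X t) x) ->
  (\forall t \ae mu, t \in `[0, T] -> forall x,
     qform (cost_at Rc Q Th Y t) x <= - qform (g t) x) ->
  forall t, t \in `[0, T] -> loewner_le (X t) (Y t).
Proof.
move=> LT pX pY sX sY XYT hX hY.
apply: (lyap_comparison (D := fun t => Y t - X t) (Linfty_drift LT)
  (Linfty_diffusion LT) (mprimitiveB pY pX)) => //.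
  by move=> t tT; rewrite linearB /= sX // sY.
apply: filterS2 hX hY => t hX hY tT x.
have := hX tT x; have := hY tT x.
rewrite /cost_at /ric_cost lyapB !qformB !qformD; lra.
Qed.

Lemma policy_solvable Rc Q Th (G : 'M[R]_d) : Linfty T Rc -> Linfty T Q -> Linfty T Th ->
  symmetric_on Rc -> (\forall t \ae mu, t \in `[0, T] -> (Q t)^T = Q t) -> G^T = G ->
  exists X, [/\ mprimitive T X (fun t => - cost_at Rc Q Th X t), X T = G & symmetric_on X].
Proof.
move=> LR LQ LT sR sQ sG.
have LN : Linfty T (fun t => Q t + (Th t)^T *m Rc t *m Th t).
  by apply: LinftyD => //; apply: LinftyM => //; apply: LinftyM => //; exact: Linfty_tr.
have [Y pY YT] := lyap_solvable T_gt0 G (Linfty_drift LT) (Linfty_diffusion LT) LN.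
(* The transpose of a solution solves the same equation because the data are symmetric; averaging
   yields a symmetric solution. *)
exists (fun t => 2^-1 *: (Y t + (Y t)^T)); split.
- have := mprimitiveZ 2^-1 (mprimitiveD pY (mprimitive_tr pY)).
  apply: eq_mprimitive; apply: filterS sQ => t sQ tT.
  set N := _ + _^T *m _ *m _.
  have sN : N^T = N by rewrite /N linearD /= (sQ tT) !trmx_mul trmxK (sR t tT) mulmxA.
  have trE (M1 M2 : 'M[R]_d) : (- (M1 + M2))^T = - (M1^T + M2^T).
    by apply/matrixP => i j; rewrite !mxE.
  have cE Z : ric_cost (A t) (B t) (C t) (D t) (Rc t) (Q t) (Th t) Z =
      lyap (A t - B t *m Th t) (C t - D t *m Th t) Z + N by rewrite /N addrA.
  rewrite trE lyap_tr sN /cost_at cE lyapZ lyapD.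
  move: (lyap _ _ (Y t)) (lyap _ _ (Y t)^T) N {sN cE} => ? ? ?.
  by apply/matrixP => ? ?; rewrite !mxE; lra.
- by rewrite YT sG; apply/matrixP => ? ?; rewrite !mxE; lra.
- by move=> t tT; rewrite linearZ linearD /= trmxK addrC.
Qed.

(** The null set is fixed before [Th], so the inequality may be used along any time-dependent
    feedback. For fixed [Th] it is linear in the data and [W], unlike the Riccati equation. *)
Definition subsolution Rc Q W := exists2 w, mprimitive T W w &
  [/\ symmetric_on W,
      forall t, t \in `[0, T] -> pdmx (weight_at Rc W t) &
      \forall t \ae mu, t \in `[0, T] -> forall (Th : 'M[R]_d) x,
        - qform (w t) x <=
        qform (ric_cost (A t) (B t) (C t) (D t) (Rc t) (Q t) Th (W t)) x].

Lemma weight_coercive_le Rc W X t (a : R) : symmetric_on W ->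
  loewner_le (W t) (X t) -> coercive a (weight_at Rc W t) -> coercive a (weight_at Rc X t).
Proof.
move=> sW WX ca x; apply: le_trans (ca x) _.
by rewrite /weight_at /ric_S !qformD lerD2l !qform_conj; exact: loewner_qform.
Qed.

Lemma policy_iteration Rc Q G W : mcontinuous T Rc -> symmetric_on Rc -> Linfty T Q ->
  (\forall t \ae mu, t \in `[0, T] -> (Q t)^T = Q t) -> G^T = G ->
  subsolution Rc Q W -> loewner_le (W T) G ->
  exists Y, [/\ mprimitive T Y (fun t => - cost_at Rc Q (feedback_at Rc Y) Y t), Y T = G,
    symmetric_on Y & forall t, t \in `[0, T] -> pdmx (weight_at Rc Y t)].
Proof.
move=> cR sR LQ sQ sG [w pW [sW pdW subW]] WG.
have LR := Linfty_mcontinuous T_gt0 cR.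
have cW := mprimitive_mcontinuous pW.
have [dl dl0 coW] := uniform_coercive (mcontinuous_weight cR cW) pdW.
(* The invariant of the iteration: lying above [W] transfers the coercivity constant [dl] of [W] to
   every iterate. *)
pose good X := [/\ mcontinuous T X, symmetric_on X &
  forall t, t \in `[0, T] -> loewner_le (W t) (X t)].
have good_co X : good X -> forall t, t \in `[0, T] -> coercive dl (weight_at Rc X t).
  by move=> [_ _ WX] t tT; apply: (weight_coercive_le sW) (coW t tT); exact: WX.
have good_fb X : good X -> Linfty T (feedback_at Rc X).
  by move=> gX; have [cX sX _] := gX; apply: (Linfty_feedback dl0) => //; exact: good_co.
have ex Th : Linfty T Th -> exists X,
    [/\ mprimitive T X (fun t => - cost_at Rc Q Th X t), X T = G & good X].
  move=> LT; have [X [pX XT sX]] := policy_solvable LR LQ LT sR sQ sG.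
  exists X; split=> //; split=> //; first exact: mprimitive_mcontinuous pX.
  apply: (cost_comparison LT pW pX) => //; first by rewrite XT.
    by apply: filterS subW => t h tT x; exact: h.
  by apply: aeW => t tT x; rewrite qformN opprK.
have exs X : exists Y, good X ->
    [/\ mprimitive T Y (fun t => - cost_at Rc Q (feedback_at Rc X) Y t), Y T = G & good Y].
  have [gX|ngX] := pselect (good X); last by exists X => /ngX.
  by have [Y YP] := ex _ (good_fb X gX); exists Y.
have [step stepP] := choice exs.
(* The initial policy is the zero feedback. *)
have L0 : Linfty T (fun=> 0 : 'M[R]_d).
  by apply: (Linfty_mcontinuous T_gt0); exact: mcontinuous_cst.
have [X0 [pX0 X0T gX0]] := ex _ L0.
pose X k := iter k step X0.
have gX k : good (X k) by elim: k => // k IH; have [] := stepP _ IH.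
pose Th k := if k is k'.+1 then feedback_at Rc (X k') else fun=> 0.
have LTh k : Linfty T (Th k) by case: k => // k; exact: good_fb.
pose f k t := - cost_at Rc Q (Th k) (X k) t.
have pX k : mprimitive T (X k) (f k) by case: k => // k; have [] := stepP _ (gX k).
have XT k : X k T = G by case: k => // k; have [] := stepP _ (gX k).
have co k := good_co _ (gX k).
have cX k : mcontinuous T (X k) by have [] := gX k.
have sX k : symmetric_on (X k) by have [] := gX k.
have WX k t : t \in `[0, T] -> loewner_le (W t) (X k t) by have [_ _] := gX k; exact.
(* Both iterates are compared under the feedback of [X k]: it is the policy of [X k.+1], and it
   minimizes the cost at [X k]. *)
have Xdecr k t : t \in `[0, T] -> loewner_le (X k.+1 t) (X k t).
  move: t; apply: (cost_comparison (LTh k.+1) (pX k.+1) (pX k)) => //.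
  - by rewrite !XT; exact: loewner_refl.
  - by apply: aeW => t tT x; rewrite qformN opprK.
  - apply: aeW => t tT x; rewrite qformN opprK; apply: ric_cost_min.
    + exact: sX.
    + exact: sR.
    + exact: coercive_pd dl0 (symmetric_weight sR (sX k) tT) (co k t tT).
have X0le k t : t \in `[0, T] -> loewner_le (X k t) (X 0%N t).
  move=> tT; elim: k => [|k IH]; first by apply: loewner_refl; exact: sX.
  apply: qform_loewner => [||x]; [exact: sX|exact: sX|].
  exact: le_trans (loewner_qform (Xdecr k t tT) x) (loewner_qform IH x).
have [c1 c10 hW] := mcontinuous_bounded T_gt0 cW.
have [c2 c20 hX0] := mcontinuous_bounded T_gt0 (mcontinuousD (cX 0%N) (mcontinuousN cW)).
(* From [0 <= X k - W <= X 0 - W] in the Loewner order, through [psd_norm_le]. *)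
have hX k t : t \in `[0, T] -> `|X k t| <= c1 + c2.
  move=> tT; rewrite -[X k t](subrK (W t)) addrC mxnormD_le ?hW //.
  apply: le_trans (hX0 t tT); apply: psd_norm_le; first exact: WX.
  have := X0le k t tT; rewrite /loewner_le opprB addrA subrK //.
have [cA cA0 hA] := Linfty_bound LA; have [cB cB0 hB] := Linfty_bound LB.
have [cC cC0 hC] := Linfty_bound LC; have [cDD cDD0 hD] := Linfty_bound LD.
have [cRR cRR0 hR] := Linfty_bound LR.
pose c := 1 + cA + cB + cC + cDD + cRR + c1 + c2 + c1 + c2.
have c0 : 0 < c by rewrite /c; lra.
have [a a0 lip] := @ric_cost_lipschitz R d c dl c0 dl0.
have bounds : \forall t \ae mu, t \in `[0, T] ->
    [/\ `|A t| <= c, `|B t| <= c, `|C t| <= c, `|D t| <= c & `|Rc t| <= c].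
  have hABC : \forall t \ae mu, t \in `[0, T] ->
      [/\ `|A t| <= cA, `|B t| <= cB & `|C t| <= cC].
    by apply: filterS3 hA hB hC => t h1 h2 h3 tT; split; [exact: h1|exact: h2|exact: h3].
  apply: filterS3 hABC hD hR => t h1 h2 h3 tT; have [hh1 hh2 hh3] := h1 tT.
  split; [apply: le_trans hh1 _|apply: le_trans hh2 _|apply: le_trans hh3 _|
    apply: le_trans (h2 tT) _|apply: le_trans (h3 tT) _]; rewrite /c; lra.
have hXc k t : t \in `[0, T] -> `|X k t| <= c.
  by move=> tT; apply: le_trans (hX k t tT) _; rewrite /c; lra.
have hf k : \forall t \ae mu, t \in `[0, T] ->
    `|f k.+2 t - f k.+1 t| <= a * (`|X k.+2 t - X k.+1 t| + `|X k.+1 t - X k t|).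
  apply: filterS bounds => t hb tT.
  (* Both rates are compared with the optimal cost at [X k.+1]: one differs from it by the state,
     the other by the feedback. *)
  have -> : f k.+2 t - f k.+1 t =
    - (cost_at Rc Q (feedback_at Rc (X k.+1)) (X k.+2) t -
       cost_at Rc Q (feedback_at Rc (X k.+1)) (X k.+1) t) +
    (cost_at Rc Q (feedback_at Rc (X k)) (X k.+1) t -
       cost_at Rc Q (feedback_at Rc (X k.+1)) (X k.+1) t).
    rewrite /f /Th; move: (cost_at _ _ _ _ _) (cost_at _ _ _ _ _) (cost_at _ _ _ _ _) => ? ? ?.
    by apply/matrixP => ? ?; rewrite !mxE; ring.
  have l1 := lip (A t) (B t) (C t) (D t) (Rc t) (Q t) (X k.+2 t) (X k.+1 t) (X k.+1 t)
    (hb tT) (hXc _ _ tT) (hXc _ _ tT) (sX _ _ tT) (sX _ _ tT) (sR _ tT)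
    (co _ _ tT) (co _ _ tT).
  have l2 := lip (A t) (B t) (C t) (D t) (Rc t) (Q t) (X k.+1 t) (X k t) (X k.+1 t)
    (hb tT) (hXc _ _ tT) (hXc _ _ tT) (sX _ _ tT) (sX _ _ tT) (sR _ tT)
    (co _ _ tT) (co _ _ tT).
  rewrite subrr normr0 addr0 in l1; rewrite subrr normr0 add0r in l2.
  apply: le_trans (ler_normD _ _) _; rewrite normrN mulrDr.
  apply: lerD; first exact: l1.
  by rewrite [`|X k.+1 t - _|]distrC; exact: l2.
have [e [L [cL hL]]] := iteration_limit T_gt0 a0 pX XT hf.
have e0 k t : t \in `[0, T] -> 0 <= e / 2 ^+ k by move=> /(hL k); exact: le_trans.
have sL : symmetric_on L.
  move=> t tT; apply/eqP; rewrite -subr_eq0 -normr_le0.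
  apply: (@le0_geometric R _ (2 * e)) => k.
  have -> : (L t)^T - L t = (X k t - L t) - (X k t - L t)^T.
    rewrite linearB /= sX //; move: (X k t) (L t) (L t)^T => ? ? ?.
    by apply/matrixP => ? ?; rewrite !mxE; ring.
  apply: le_trans (mxnormB_le (hL k t tT) _) _.
    by rewrite mxnorm_tr; exact: hL.
  by lra.
(* The order passes to the limit, so [L] inherits the coercivity constant and its feedback is
   bounded. *)
have WL t : t \in `[0, T] -> loewner_le (W t) (L t).
  move=> tT; apply: qform_loewner => [||x]; [exact: sW|exact: sL|].
  rewrite -subr_le0; apply: (@le0_geometric R _ (2 * d%:R * sqnorm x * e)) => k.
  have h1 := loewner_qform (WX k t tT) x.
  have := qform_le (X k t - L t) x; rewrite qformB => /(le_trans (ler_norm _)) h2.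
  have h3 : 2 * d%:R * `|X k t - L t| * sqnorm x <= 2 * d%:R * (e / 2 ^+ k) * sqnorm x.
    by rewrite ler_wpM2r ?sqnorm_ge0 // ler_wpM2l ?mulr_ge0 // hL.
  by move: h1 h2 h3; lra.
have gL : good L by [].
have LfL := good_fb L gL.
have Lg : Linfty T (fun t => - cost_at Rc Q (feedback_at Rc L) L t).
  apply: LinftyN; apply: Linfty_cost => //; exact: Linfty_mcontinuous.
have hLc t : t \in `[0, T] -> `|L t| <= c.
  move=> tT; rewrite -subr_le0; apply: (@le0_geometric R _ e) => k.
  have -> : L t = X k t - (X k t - L t) by rewrite opprB addrC subrK.
  have := mxnormB_le (hX k t tT) (hL k t tT); rewrite /c; lra.
have hg k : \forall t \ae mu, t \in `[0, T] ->
    `|f k.+1 t - - cost_at Rc Q (feedback_at Rc L) L t| <= 2 * (a * e) / 2 ^+ k.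
  apply: filterS bounds => t hb tT.
  have l1 := lip (A t) (B t) (C t) (D t) (Rc t) (Q t) (X k.+1 t) (X k t) (L t)
    (hb tT) (hXc _ _ tT) (hLc _ tT) (sX _ _ tT) (sL _ tT) (sR _ tT)
    (co _ _ tT) (good_co _ gL _ tT).
  rewrite opprK /f addrC distrC; apply: le_trans l1 _.
  have h1 := hL k.+1 t tT; have h2 := hL k t tT.
  have -> : 2 * (a * e) / 2 ^+ k = a * (2 * (e / 2 ^+ k)) by ring.
  rewrite ler_pM2l //.
  have h3 : e / 2 ^+ k.+1 = (e / 2 ^+ k) / 2 by rewrite exprS; field; rewrite expf_neq0.
  by have := e0 k t tT; move: h1 h2; rewrite h3; lra.
(* [L] is determined only on [[0, T]]; [Y] is a primitive that agrees with it there. *)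
have [Y [pY YT YL]] := limit_primitive T_gt0 pX XT hL Lg hg.
exists Y; split=> //.
- apply: eq_mprimitive pY; apply: aeW => t tT.
  by rewrite /cost_at /feedback_at YL.
- by move=> t tT; rewrite YL //; exact: sL.
- move=> t tT; rewrite /weight_at YL //.
  exact: coercive_pd dl0 (symmetric_weight sR sL tT) (good_co L gL t tT).
Qed.

End RiccatiEquation.

(** * Solutions and subsolutions of the Riccati problem *)

Section Solutions.
Context {R : realType} (d : nat) (T : R).
Hypothesis T_gt0 : 0 < T.
Notation mu := (@lebesgue_measure R).
Variables (A B C D : R -> 'M[R]_d).
Hypotheses (LA : Linfty T A) (LB : Linfty T B) (LC : Linfty T C).
Hypothesis D_cont : {within `[0, T], continuous D}.

Let cD : mcontinuous T D := within_mcontinuous D_cont.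

Notation cost_at := (cost_at A B C D).
Notation feedback_at := (feedback_at B C D).
Notation weight_at := (weight_at D).
Notation subsolution := (subsolution T A B C D).
Notation sol := (riccati_solution T A B C D).

Lemma mprimitive_derive1 (P : R -> 'M[R]_d) : abs_continuous 0 T P ->
  (\forall t \ae mu, t \in `[0, T] -> derivable P t 1) -> mprimitive T P (derive1 P).
Proof.
move=> acP dP i j; split.
  move=> e /acP[dl dl0 h]; exists dl => // n u v uv dis l.
  apply: le_lt_trans (h n u v uv dis l); apply: ler_sum => k _.
  by have := le_mxnorm (P (v k) - P (u k)) i j; rewrite !mxE.
apply: filterS dP => t dP tT; have dPt := dP tT.
split; first by have /derivable_mxP := dPt; apply.
by rewrite derive1E derive_mx // mxE.
Qed.

Lemma mprimitive_derivable (P p : R -> 'M[R]_d) : mprimitive T P p ->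
  abs_continuous 0 T P /\
  \forall t \ae mu, t \in `[0, T] -> derivable P t 1 /\ derive1 P t = p t.
Proof.
move=> pP; split.
  move=> e e0.
  (* [e] is shared among the entries; the [+ 1] keeps the total strictly below [e]. *)
  have N0 : 0 < (#|{: 'I_d * 'I_d}|%:R + 1) :> R by rewrite ltr_wpDl.
  have h (ij : 'I_d * 'I_d) : exists dl : R, 0 < dl /\
      forall n (u v : 'I_n -> R), (forall i, 0 <= u i /\ u i <= v i /\ v i <= T) ->
      (forall i j, i != j -> v i <= u j \/ v j <= u i) -> \sum_i (v i - u i) < dl ->
      \sum_i `|P (v i) ij.1 ij.2 - P (u i) ij.1 ij.2| <
        e / (#|{: 'I_d * 'I_d}|%:R + 1).
    have [acP _] := pP ij.1 ij.2.
    by have [dl dl0 hh] := acP _ (divr_gt0 e0 N0); exists dl.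
  have [dl dlP] := choice h.
  exists (\big[Num.min/1]_ij dl ij).
    by apply: lt_bigmin => // ij _; have [] := dlP ij.
  move=> n u v uv dis l.
  apply: (@le_lt_trans _ _
    (\sum_(ij : 'I_d * 'I_d) \sum_k `|P (v k) ij.1 ij.2 - P (u k) ij.1 ij.2|)).
    rewrite exchange_big /=; apply: ler_sum => k _.
    apply: mxnorm_le => [|i j]; first exact: sumr_ge0.
    by rewrite (bigD1 (i, j)) //= !mxE lerDl sumr_ge0.
  apply: (@le_lt_trans _ _ (\sum_(ij : 'I_d * 'I_d) e / (#|{: 'I_d * 'I_d}|%:R + 1))).
    apply: ler_sum => ij _; apply/ltW; have [_] := dlP ij; apply=> //.
    by apply: lt_le_trans l _; exact: bigmin_le.
  rewrite sumr_const -[(e / _) *+ _]mulr_natl mulrCA gtr_pMr // ltr_pdivrMr // mul1r.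
  by rewrite ltrDl.
have h (ij : 'I_d * 'I_d) : \forall t \ae mu, t \in `[0, T] ->
    is_derive t 1 (fun t => P t ij.1 ij.2) (p t ij.1 ij.2).
  by have [_] := pP ij.1 ij.2.
have {h} : \forall t \ae mu, forall ij : 'I_d * 'I_d, t \in `[0, T] ->
    is_derive t 1 (fun t => P t ij.1 ij.2) (p t ij.1 ij.2).
  exact: filter_forall.
apply: filterS => t h tT.
have dP : derivable P t 1.
  by apply/derivable_mxP => i j; have [] := h (i, j) tT.
split=> //; rewrite derive1E derive_mx //; apply/matrixP => i j.
by rewrite mxE; have [_] := h (i, j) tT.
Qed.

Lemma data_spaceP Rc Q (G : 'M[R]_d) : data_space T (Rc, Q, G) ->
  [/\ mcontinuous T Rc, symmetric_on T Rc, Linfty T Q,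
     \forall t \ae mu, t \in `[0, T] -> (Q t)^T = Q t & G^T = G].
Proof.
move=> [cR sR LQ sQ sG]; split=> //.
- exact: within_mcontinuous.
- by move=> t tT; exact/symmetricmxP/sR.
- by apply: filterS sQ => t sQ tT; exact/symmetricmxP/sQ.
- exact/symmetricmxP.
Qed.

(** The Riccati equation is [- P' = J(Th, P)] for the feedback [Th] of [P]; this identity translates
    between the two forms. *)
Lemma riccati_rhs (Rc Q P : R -> 'M[R]_d) t : (P t)^T = P t -> (Rc t)^T = Rc t ->
  pdmx (weight_at Rc P t) ->
  let K := P t *m B t + (C t)^T *m P t *m D t in
  - cost_at Rc Q (feedback_at Rc P) P t + (A t)^T *m P t + P t *m A t +
    (C t)^T *m P t *m C t + Q t =
  K *m invmx (Rc t + (D t)^T *m P t *m D t) *m K^T.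
Proof.
move=> sP sR pS K; have [a a0 ca] := pd_coercive pS.
have uS := coercive_unit a0 (ric_S_sym (D t) sP sR) ca.
have E : cost_at Rc Q (feedback_at Rc P) P t = _ :=
  ric_cost_feedback (A t) (B t) (C t) (Q t) sP sR uS.
rewrite E /lyap /K -/(ric_S (D t) (Rc t) (P t)).
rewrite -/(ric_K (B t) (C t) (D t) (P t)).
move: (_ *m invmx _ *m _) (_^T *m P t) (P t *m A t) (_ *m C t) => ? ? ? ?.
by apply/matrixP => ? ?; rewrite !mxE; ring.
Qed.

Lemma solution_primitive Rc Q G P : data_space T (Rc, Q, G) -> sol (Rc, Q, G) P ->
  [/\ mprimitive T P (fun t => - cost_at Rc Q (feedback_at Rc P) P t),
      symmetric_on T P, P T = G &
      forall t, t \in `[0, T] -> pdmx (weight_at Rc P t)].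
Proof.
move=> /data_spaceP[cR sR LQ sQ sG] [sP acP eqP PT pdP].
have sP' : symmetric_on T P by move=> t tT; exact/symmetricmxP/sP.
split=> //; have dP : \forall t \ae mu, t \in `[0, T] -> derivable P t 1.
  by apply: filterS eqP => t h tT; have [] := h tT.
apply: eq_mprimitive (mprimitive_derive1 acP dP); apply: filterS eqP => t h tT.
have [_ /= E] := h tT.
have := riccati_rhs Q (sP' t tT) (sR t tT) (pdP t tT); rewrite /= -E.
by move=> /addIr/addIr/addIr/addIr.
Qed.

Lemma primitive_solution Rc Q G P : data_space T (Rc, Q, G) ->
  mprimitive T P (fun t => - cost_at Rc Q (feedback_at Rc P) P t) ->
  symmetric_on T P -> P T = G ->
  (forall t, t \in `[0, T] -> pdmx (weight_at Rc P t)) -> sol (Rc, Q, G) P.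
Proof.
move=> /data_spaceP[cR sR LQ sQ sG] pP sP PT pdP.
have [acP dP] := mprimitive_derivable pP; split=> //.
  by move=> t tT; exact/symmetricmxP/sP.
apply: filterS dP => t h tT; have [h1 h2] := h tT; split=> //=.
by rewrite h2; apply: riccati_rhs; [exact: sP|exact: sR|exact: pdP].
Qed.

Lemma solution_subsolution Rc Q G P : data_space T (Rc, Q, G) -> sol (Rc, Q, G) P ->
  subsolution Rc Q P.
Proof.
move=> dp sp; have [pP sP PT pdP] := solution_primitive dp sp.
have [cR sR _ _ _] := data_spaceP dp.
exists (fun t => - cost_at Rc Q (feedback_at Rc P) P t) => //.
split=> //; apply: aeW => t tT Th x; rewrite qformN opprK.
by apply: ric_cost_min; [exact: sP|exact: sR|exact: pdP].
Qed.

Lemma subsolution_solvable Rc Q G W : data_space T (Rc, Q, G) -> subsolution Rc Q W ->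
  loewner_le (W T) G ->
  solvable_set T A B C D (Rc, Q, G) /\
  forall P, sol (Rc, Q, G) P -> forall t, t \in `[0, T] -> loewner_le (W t) (P t).
Proof.
move=> dp subW WG; have [cR sR LQ sQ sG] := data_spaceP dp; split.
  split=> //; have [Y [pY YT sY pdY]] :=
    policy_iteration T_gt0 LA LB LC cD cR sR LQ sQ sG subW WG.
  by exists Y; exact: primitive_solution.
(* Any solution, however obtained, is compared with [W] under its own feedback, for which it solves
   the linear equation exactly. *)
move=> P /(solution_primitive dp)[pP sP PT pdP].
have cP := mprimitive_mcontinuous pP.
have [a a0 ha] := uniform_coercive T_gt0 (mcontinuous_weight cD cR cP) pdP.
have LT := Linfty_feedback T_gt0 LB LC cD a0 cR cP sR sP ha.
have [w pW [sW _ hW]] := subW.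
apply: (cost_comparison T_gt0 LA LB LC cD LT pW pP) => //; first by rewrite PT.
  by apply: filterS hW => t h tT x; exact: h.
by apply: aeW => t tT x; rewrite qformN opprK.
Qed.

(** * Stability of subsolutions and of the data space *)

Lemma subsolutionD Rc Q W Rc' Q' W' : subsolution Rc Q W -> subsolution Rc' Q' W' ->
  subsolution (Rc + Rc') (Q + Q') (fun t => W t + W' t).
Proof.
move=> [w pw [sW pdW hW]] [w' pw' [sW' pdW' hW']].
exists (fun t => w t + w' t); first exact: mprimitiveD.
split.
- by move=> t tT; rewrite linearD /= sW // sW'.
- move=> t tT; rewrite /weight_at ric_SD.
  have [s1 p1] := pdW t tT; have [s2 p2] := pdW' t tT; split.
    by apply/symmetricmxP; rewrite linearD /=; congr (_ + _); exact/symmetricmxP.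
  move=> x x0; rewrite -/(bform _ _ _) -/(qform _ _) qformD.
  by rewrite addr_gt0 //; [exact: p1|exact: p2].
- apply: filterS2 hW hW' => t h h' tT Th x; rewrite ric_costD.
  move: (h tT Th x) (h' tT Th x); rewrite (qformD (w t)).
  move: (ric_cost _ _ _ _ (Rc t) _ _ _) (ric_cost _ _ _ _ (Rc' t) _ _ _) => M N.
  by rewrite (qformD M); lra.
Qed.

Lemma subsolutionZ Rc Q W (l : R) : 0 < l -> subsolution Rc Q W ->
  subsolution (l *: Rc) (l *: Q) (fun t => l *: W t).
Proof.
move=> l0 [w pw [sW pdW hW]].
exists (fun t => l *: w t); first exact: mprimitiveZ.
split.
- by move=> t tT; rewrite linearZ /= sW.
- move=> t tT; rewrite /weight_at ric_SZ; have [s1 p1] := pdW t tT; split.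
    by apply/symmetricmxP; rewrite linearZ /=; congr (_ *: _); exact/symmetricmxP.
  move=> x x0; rewrite -/(bform _ _ _) -/(qform _ _) qformZ.
  by rewrite mulr_gt0 //; exact: p1.
- apply: filterS hW => t h tT Th x; rewrite ric_costZ !qformZ -mulrN.
  by rewrite ler_pM2l //; exact: h.
Qed.

Lemma subsolution_le Rc Q W Rc' Q' : symmetric_on T Rc' -> subsolution Rc Q W ->
  (forall t, t \in `[0, T] -> loewner_le (Rc t) (Rc' t)) ->
  (\forall t \ae mu, t \in `[0, T] -> loewner_le (Q t) (Q' t)) ->
  subsolution Rc' Q' W.
Proof.
move=> sR' [w pw [sW pdW hW]] RR QQ; exists w => //; split=> //.
- move=> t tT; split.
    by apply/symmetricmxP/ric_S_sym; [exact: sW|exact: sR'].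
  move=> x x0; rewrite -/(bform _ _ _) -/(qform _ _).
  apply: lt_le_trans (proj2 (pdW t tT) x x0) _.
  rewrite -/(bform _ _ _) -/(qform _ _) /ric_S !qformD lerD2r.
  exact/loewner_qform/RR.
- apply: filterS2 hW QQ => t h hQ tT Th x; apply: le_trans (h tT Th x) _.
  rewrite /ric_cost; move: (lyap _ _ _) => L; rewrite !qformD !qform_conj.
  have := loewner_qform (hQ tT) x; have := loewner_qform (RR t tT) (Th *m x).
  by lra.
Qed.

Lemma data_spaceD (p q : riccati_data R d) : data_space T p -> data_space T q ->
  data_space T (p + q).
Proof.
move: p q => [[Rc Q] G] [[Rc' Q'] G'] [c1 s1 l1 t1 g1] [c2 s2 l2 t2 g2].
have symD (M N : 'M[R]_d) : M \is symmetricmx -> N \is symmetricmx ->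
    M + N \is symmetricmx.
  by move=> /symmetricmxP sM /symmetricmxP sN; apply/symmetricmxP; rewrite linearD /= sM sN.
split.
- by move=> x; apply: cvgD; [exact: c1|exact: c2].
- by move=> t tT; apply: symD; [exact: s1|exact: s2].
- exact: LinftyD.
- by apply: filterS2 t1 t2 => t h1 h2 tT; apply: symD; [exact: h1|exact: h2].
- exact: symD.
Qed.

Lemma data_spaceZ (l : R) (p : riccati_data R d) : data_space T p ->
  data_space T (l *: p).
Proof.
move: p => [[Rc Q] G] [c1 s1 l1 t1 g1].
have symZ (M : 'M[R]_d) : M \is symmetricmx -> l *: M \is symmetricmx.
  by move=> /symmetricmxP sM; apply/symmetricmxP; rewrite linearZ /= sM.
split.
- by move=> x; apply: cvgZl_tmp; exact: c1.
- by move=> t tT; apply: symZ; exact: s1.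
- exact: LinftyZ.
- by apply: filterS t1 => t h1 tT; apply: symZ; exact: h1.
- exact: symZ.
Qed.

End Solutions.

(** * The solvable set and its order properties *)

Theorem theorem2p2 (R : realType) (d : nat) (T : R) (A B C D : R -> 'M[R]_d)
    (T_gt0 : 0 < T) (d_ge1 : (1 <= d)%N)
    (A_Loo : Linfty T A) (B_Loo : Linfty T B) (C_Loo : Linfty T C)
    (D_cont : {within `[0, T], continuous D}) :
  let S := solvable_set T A B C D in
  let sol := riccati_solution T A B C D in
  (S !=set0 /\ convex_cone S /\ (forall p, data_eq T p 0 -> ~ S p)) /\
  [/\ (* (a) positive homogeneity *)
      forall p (l : R), S p -> 0 < l ->
        S (l *: p) /\
        forall P Pl, sol p P -> sol (l *: p) Pl ->
          forall t : R, t \in `[0, T] -> Pl t = l *: P t,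
      (* (b) super-additivity *)
      forall p q, S p -> S q ->
        S (p + q) /\
        forall P Pq Ps, sol p P -> sol q Pq -> sol (p + q) Ps ->
          forall t : R, t \in `[0, T] -> loewner_le (P t + Pq t) (Ps t)
    & (* (c) monotonicity *)
      forall Rc Q G Rc' Q' G', S (Rc, Q, G) -> data_space T (Rc', Q', G') ->
        (forall t : R, t \in `[0, T] -> loewner_le (Rc t) (Rc' t)) ->
        (\forall t \ae (@lebesgue_measure R),
            t \in `[0, T] -> loewner_le (Q t) (Q' t)) ->
        loewner_le G G' ->
        S (Rc', Q', G') /\
        forall P P', sol (Rc, Q, G) P -> sol (Rc', Q', G') P' ->
          forall t : R, t \in `[0, T] -> loewner_le (P t) (P' t)].
Proof.
move=> S sol.
have symGP (Rc Q : R -> 'M[R]_d) G : data_space T (Rc, Q, G) -> G^T = G.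
  by move=> dp; have [] := data_spaceP dp.
have T_in : T \in `[0, T] by rewrite in_itv /= lexx ltW.
have main := subsolution_solvable T_gt0 A_Loo B_Loo C_Loo D_cont.
have homog p (l : R) : S p -> 0 < l -> S (l *: p) /\
    forall P Pl, sol p P -> sol (l *: p) Pl ->
      forall t : R, t \in `[0, T] -> Pl t = l *: P t.
  move: p => [[Rc Q] G] [dp [P0 sP0]] l0.
  have dlp := data_spaceZ l dp.
  have up P : sol (Rc, Q, G) P -> S (l *: Rc, l *: Q, l *: G) /\
      forall Pl, sol (l *: Rc, l *: Q, l *: G) Pl ->
        forall t, t \in `[0, T] -> loewner_le (l *: P t) (Pl t).
    move=> sP; apply: main => //.
      by apply: subsolutionZ => //; exact: solution_subsolution sP.
    have [_ _ _ -> _] := sP.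
    by apply: loewner_refl; rewrite linearZ /= (symGP _ _ _ dp).
  split; first exact: (up P0 sP0).1.
  (* One inequality says that [l *: P] is a subsolution of the scaled data; the other, that
     [l^-1 *: Pl] is one of the original data. *)
  move=> P Pl sP sPl t tT; apply: loewner_antisym; last exact: (up P sP).2.
  have lV0 : 0 < l^-1 by rewrite invr_gt0.
  have lK (F : R -> 'M[R]_d) : l^-1 *: (l *: F) = F.
    by rewrite scalerA mulVf ?scale1r // gt_eqF.
  have subPl := subsolutionZ lV0 (solution_subsolution dlp sPl).
  rewrite !lK in subPl.
  have [|_ /(_ P sP t tT) h] := main _ _ _ _ dp subPl.
    have [_ _ _ -> _] := sPl.
    rewrite scalerA mulVf ?gt_eqF // scale1r.
    exact: loewner_refl (symGP _ _ _ dp).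
  have [sP' _ _ _ _] := sP; have [sPl' _ _ _ _] := sPl.
  apply: qform_loewner => [||x].
  - exact/symmetricmxP/sPl'.
  - by rewrite linearZ /=; congr (_ *: _); exact/symmetricmxP/sP'.
  - by have := loewner_qform h x; rewrite !qformZ ler_pdivrMl.
have super p q : S p -> S q -> S (p + q) /\
    forall P Pq Ps, sol p P -> sol q Pq -> sol (p + q) Ps ->
      forall t : R, t \in `[0, T] -> loewner_le (P t + Pq t) (Ps t).
  move: p q => [[Rc Q] G] [[Rc' Q'] G'] [dp [P0 sP0]] [dq [Pq0 sPq0]].
  have dpq := data_spaceD dp dq.
  have up P Pq : sol (Rc, Q, G) P -> sol (Rc', Q', G') Pq ->
      S (Rc + Rc', Q + Q', G + G') /\
      forall Ps, sol (Rc + Rc', Q + Q', G + G') Ps ->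
        forall t, t \in `[0, T] -> loewner_le (P t + Pq t) (Ps t).
    move=> sP sPq; apply: main => //.
      by apply: subsolutionD; [exact: solution_subsolution sP|exact: solution_subsolution sPq].
    have [_ _ _ -> _] := sP; have [_ _ _ -> _] := sPq.
    by apply: loewner_refl; rewrite linearD /= (symGP _ _ _ dp) (symGP _ _ _ dq).
  split; first exact: (up _ _ sP0 sPq0).1.
  by move=> P Pq Ps sP sPq; exact: (up _ _ sP sPq).2.
(* For the data [(1, 0, 0)] the zero function is a subsolution, its cost being [Th^T Th]. *)
have nonempty : S !=set0.
  have sym0 : (0 : 'M[R]_d)^T = 0 by rewrite linear0.
  have L0 : Linfty T (fun=> 0 : 'M[R]_d).
    by apply: (Linfty_mcontinuous T_gt0); exact: mcontinuous_cst.
  have [|||S1 _] := main (fun=> 1%:M) (fun=> 0) 0 (fun=> 0).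
  - split=> //; last exact/symmetricmxP.
    + by move=> x; exact: cvg_cst.
    + by move=> t _; apply/symmetricmxP; rewrite trmx1.
    + by apply: aeW => t _; exact/symmetricmxP.
  - exists (fun=> 0).
      move=> i j; rewrite (_ : (fun _ => _) = fun=> 0); last by apply/funext => t; rewrite mxE.
      exact: primitive_on_cst.
    split=> //.
      move=> t _; rewrite /weight_at /ric_S mulmx0 mul0mx addr0.
      by apply: (@coercive_pd _ _ 1) => // [|x]; rewrite ?trmx1 ?qform1 ?mul1r.
    apply: aeW => t _ Th x; rewrite /ric_cost /lyap !mulmx0 !mul0mx !add0r qform_conj qform1.
    by rewrite /qform /bform mulmx0 mul0mx mxE oppr0 sqnorm_ge0.
  - exact: loewner_refl.
  by exists (fun=> 1%:M, fun=> 0, 0).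
(* At time [T] the weight of the zero data vanishes; the all-ones vector, nonzero since [d >= 1],
   contradicts its positivity. *)
have origin p : data_eq T p 0 -> ~ S p.
  move: p => [[Rc Q] G] [/= R0 _ G0] [dp [P [_ _ _ PT pd]]].
  have [_ /(_ (const_mx 1))] := pd T T_in.
  rewrite PT G0 (R0 T T_in) mulmx0 mul0mx addr0 mulmx0 mul0mx mxE ltxx => h.
  suff : false by []. apply: h.
  apply/eqP => /matrixP/(_ (Ordinal d_ge1) 0); rewrite !mxE => /eqP.
  by rewrite oner_eq0.
have cone : convex_cone S.
  split; last by move=> l v l0 Sv; exact: (homog v l Sv l0).1.
  (* Only weights strictly between [0] and [1] remain, so both scalars are positive and homogeneity
     followed by super-additivity concludes. *)
  apply/convex_setW => p q /set_mem Sp /set_mem Sq k k0 k1; apply/mem_set.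
  have k1' : 0 < 1 - k%:num by rewrite subr_gt0.
  exact: (super _ _ (homog p _ Sp k0).1 (homog q _ Sq k1').1).1.
split; first by split.
split=> //.
move=> Rc Q G Rc' Q' G' [dp [P0 sP0]] dq RR QQ GG.
have [_ sR' _ _ _] := data_spaceP dq.
have up P : sol (Rc, Q, G) P -> S (Rc', Q', G') /\
    forall P', sol (Rc', Q', G') P' ->
      forall t, t \in `[0, T] -> loewner_le (P t) (P' t).
  move=> sP; apply: main => //; last by have [_ _ _ -> _] := sP.
  by apply: subsolution_le RR QQ => //; exact: solution_subsolution sP.
split; first exact: (up P0 sP0).1.
by move=> P P' sP; exact: (up P sP).2.
Qed.
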